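(* Let $A$ be a semilattice of groups. Up to identification of isomorphic groups and semigroups, there is a one-to-one correspondence between twisted partial actions of groups on $A$ and Sieben twisted module structures on $A$ over $E$-unitary inverse semigroups, given by $\Theta\mapsto\Lambda^\Theta$ and $\Lambda\mapsto\Theta^\Lambda$; that is: for every Sieben twisted $S$-module structure $\Lambda$ on $A$ with $S$ $E$-unitary there is an isomorphism $\nu:S\to E(A)*_{\theta}\mathcal G(S)$ (where $\Theta^\Lambda=(\theta,w)$) with $\Lambda=\Lambda^{\Theta^\Lambda}\circ\nu$, and for every twisted partial action $\Theta$ of a group $G$ on $A$ there is an isomorphism $\nu:G\to\mathcal G(E(A)*_\theta G)$ with $\Theta=\Theta^{\Lambda^\Theta}\circ\nu$. Moreover, equivalent twisted partial actions correspond to equivalent Sieben twisted modules (in both directions).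
   Context: A semilattice of groups is an inverse semigroup $A$ with central idempotents; $A_e=\{a: aa^{-1}=a^{-1}a=e\}$ for $e\in E(A)$. For an inverse semigroup $S$: $\sigma$ is the minimum group congruence, $\mathcal G(S)=S/\sigma$, $\sigma^\natural:S\to\mathcal G(S)$; $S$ is $E$-unitary if $e\le s$ with $e\in E(S)$ forces $s\in E(S)$. An endomorphism $\varphi$ of $A$ is relatively invertible if there are an endomorphism $\bar\varphi$ and $e_\varphi\in E(A)$ with $\bar\varphi(\varphi(a))=e_\varphi a$, $\varphi(\bar\varphi(a))=\varphi(e_\varphi)a$ for all $a$, $e_\varphi$ the identity of $\bar\varphi(A)$ and $\varphi(e_\varphi)$ the identity of $\varphi(A)$. A twisted $S$-module structure on $A$ is $\Lambda=(\alpha,\lambda,f)$ with $\alpha:E(S)\to E(A)$ an isomorphism, $s\mapsto\lambda_s$ a map from $S$ to relatively invertible endomorphisms, $f:S\times S\to A$ with $f(s,t)\in A_{\alpha(stt^{-1}s^{-1})}$, such that (i) $\lambda_e(a)=\alpha(e)a$ ($e\in E(S)$); (ii) $\lambda_s(\alpha(e))=\alpha(ses^{-1})$; (iii) $\lambda_s(\lambda_t(a))=f(s,t)\lambda_{st}(a)f(s,t)^{-1}$; (iv) $f(se,e)=\alpha(ses^{-1})$, $f(e,es)=\alpha(ess^{-1})$; (v) $\lambda_s(f(t,u))f(s,tu)=f(s,t)f(st,u)$. It is Sieben if $f(s,e)=\alpha(ses^{-1})$ and $f(e,s)=\alpha(ess^{-1})$ for all $s\in S,e\in E(S)$. Two structures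 $(\alpha,\lambda,f),(\alpha',\lambda',f')$ over $S$ are equivalent if $\alpha'=\alpha$ and there is $g:S\to A$ with $g(s)\in A_{\alpha(ss^{-1})}$, $\lambda'_s(a)=g(s)\lambda_s(a)g(s)^{-1}$ and $f'(s,t)g(st)=g(s)\lambda_s(g(t))f(s,t)$. For an isomorphism $\nu:S\to S'$ and a structure $\Lambda'$ over $S'$, $\Lambda'\circ\nu=(\alpha'\circ\nu|_{E(S)},\lambda'\circ\nu,f'\circ(\nu\times\nu))$. Multipliers and twisted partial actions: a multiplier of a semigroup $T$ is a pair $(L,R)$ of maps $T\to T$ with $L(st)=L(s)t$, $R(st)=sR(t)$, $sL(t)=R(s)t$, written $ws=L(s)$, $sw=R(s)$; they form a monoid $\mathcal M(T)$ with unit group $\mathcal U(\mathcal M(T))$. A twisted partial action of a group $G$ on $A$ is $\Theta=(\theta,w)$, $\theta_x:D_{x^{-1}}\to D_x$ isomorphisms of nonempty ideals, $w_{x,y}\in\mathcal U(\mathcal M(D_xD_{xy}))$, with (i) $D_x^2=D_x$, $D_xD_y=D_yD_x$; (ii) $D_1=A$, $\theta_1=\mathrm{id}$; (iii) $\theta_x(D_{x^{-1}}D_y)=D_xD_{xy}$; (iv) $\theta_x\theta_y(s)=w_{x,y}\theta_{xy}(s)w_{x,y}^{-1}$ for $s\in D_{y^{-1}}D_{y^{-1}x^{-1}}$; (v) $w_{1,x}=w_{x,1}=$ identity of $D_x$; (vi) $\theta_x(sw_{y,z})w_{x,yz}=\theta_x(s)w_{x,y}w_{xy,z}$ for $s\in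 D_{x^{-1}}D_yD_{yz}$. Two such, $(\theta,w)$ and $(\theta',w')$, are equivalent if $D'_x=D_x$ and there are $\varepsilon_x\in\mathcal U(\mathcal M(D_x))$ with $\theta'_x(s)=\varepsilon_x\theta_x(s)\varepsilon_x^{-1}$ ($s\in D_{x^{-1}}$) and $\theta'_x(s)w'_{x,y}\varepsilon_{xy}=\varepsilon_x\theta_x(s\varepsilon_y)w_{x,y}$ ($s\in D_{x^{-1}}D_y$). For an isomorphism $\nu:G\to G'$ and $\Theta'$ on $G'$, $\Theta'\circ\nu$ is given by $\theta'_{\nu(x)}$, $w'_{\nu(x),\nu(y)}$. Construction $\Theta^\Lambda$ (for $\Lambda$ Sieben over $E$-unitary $S$): for $x\in\mathcal G(S)$ (a $\sigma$-class), $D_x=\bigsqcup_{s\in x}A_{\alpha(ss^{-1})}$; for $a\in D_{x^{-1}}$, $\theta_x(a)=\lambda_s(a)$ where $s\in x$ is the unique element with $\alpha(s^{-1}s)=aa^{-1}$; for $a\in D_xD_{xy}$, $w_{x,y}a=f(s,s^{-1}t)a$, $aw_{x,y}=af(s,s^{-1}t)$ where $s\in x$, $t\in xy$ are the unique elements with $\alpha(ss^{-1})=\alpha(tt^{-1})=aa^{-1}$. This is a twisted partial action of $\mathcal G(S)$ on $A$. Construction $\Lambda^\Theta$ (for a twisted partial action $\Theta=(\theta,w)$ of $G$ on $A$): $\theta$ restricts to isomorphisms $E(D_{x^{-1}})\to E(D_x)$; $E(A)*_\theta G=\{e\delta_x: e\in E(D_x)\}$ with $e\delta_x\cdot f\delta_y=\theta_x(\theta_x^{-1}(e)f)\delta_{xy}$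 is an $E$-unitary inverse semigroup. Then $\Lambda^\Theta=(\alpha,\lambda,f)$ over $E(A)*_\theta G$ with $\alpha(e\delta_1)=e$, $\lambda_{e\delta_x}(a)=\theta_x(\theta_x^{-1}(e)a)$, $f(e\delta_x,e'\delta_y)=\theta_x(\theta_x^{-1}(e)e')w_{x,y}$; it is a Sieben twisted module structure. *)

(* Defs.v *)
From Stdlib Require Import ClassicalEpsilon.

Set Implicit Arguments.

Definition seteq {X : Type} (P Q : X -> Prop) : Prop := forall x, P x <-> Q x.
Definition image {X : Type} (f : X -> X) (P : X -> Prop) : X -> Prop :=
  fun b => exists a, P a /\ b = f a.

Record sgrp (T : Type) := Sgrp { s_car : T -> Prop; s_mul : T -> T -> T }.

Definition closed_assoc {T} (S : sgrp T) : Prop :=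
  (forall x y, s_car S x -> s_car S y -> s_car S (s_mul S x y)) /\
  (forall x y z, s_car S x -> s_car S y -> s_car S z ->
     s_mul S (s_mul S x y) z = s_mul S x (s_mul S y z)).

Definition is_inverse_of {T} (S : sgrp T) (x y : T) : Prop :=
  s_car S y /\ s_mul S (s_mul S x y) x = x /\ s_mul S (s_mul S y x) y = y.

Definition inverse_semigroup {T} (S : sgrp T) : Prop :=
  closed_assoc S /\ (exists x, s_car S x) /\
  (forall x, s_car S x -> exists! y, is_inverse_of S x y).

(* the inverse s^{-1} (meaningful for s in an inverse semigroup) *)
Definition sinv {T} (S : sgrp T) (x : T) : T :=
  epsilon (inhabits x) (is_inverse_of S x).

Definition idem {T} (S : sgrp T) (e : T) : Prop := s_car S e /\ s_mul S e e = e.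

Definition nat_le {T} (S : sgrp T) (s t : T) : Prop :=
  exists e, idem S e /\ s = s_mul S e t.

Definition E_unitary {T} (S : sgrp T) : Prop :=
  forall e s, idem S e -> s_car S s -> nat_le S e s -> idem S s.

Definition sgrp_iso {T T'} (S : sgrp T) (S' : sgrp T') (nu : T -> T') : Prop :=
  (forall s, s_car S s -> s_car S' (nu s)) /\
  (forall s t, s_car S s -> s_car S t -> nu s = nu t -> s = t) /\
  (forall s', s_car S' s' -> exists s, s_car S s /\ nu s = s') /\
  (forall s t, s_car S s -> s_car S t -> nu (s_mul S s t) = s_mul S' (nu s) (nu t)).

Definition full_sgrp {A} (amul : A -> A -> A) : sgrp A := Sgrp (fun _ => True) amul.

Definition semilattice_of_groups {A} (amul : A -> A -> A) : Prop :=
  inverse_semigroup (full_sgrp amul) /\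
  (forall e a, idem (full_sgrp amul) e -> amul e a = amul a e).

Definition ainv {A} (amul : A -> A -> A) (a : A) : A := sinv (full_sgrp amul) a.
Definition idemA {A} (amul : A -> A -> A) (e : A) : Prop := idem (full_sgrp amul) e.

Definition Hgrp {A} (amul : A -> A -> A) (e a : A) : Prop :=
  amul a (ainv amul a) = e /\ amul (ainv amul a) a = e.

Record grp (T : Type) :=
  Grp { g_car : T -> Prop; g_mul : T -> T -> T; g_one : T; g_inv : T -> T }.

Definition group {T} (G : grp T) : Prop :=
  (forall x y, g_car G x -> g_car G y -> g_car G (g_mul G x y)) /\
  (forall x y z, g_car G x -> g_car G y -> g_car G z ->
     g_mul G (g_mul G x y) z = g_mul G x (g_mul G y z)) /\
  g_car G (g_one G) /\
  (forall x, g_car G x -> g_mul G (g_one G) x = x /\ g_mul G x (g_one G) = x) /\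
  (forall x, g_car G x -> g_car G (g_inv G x) /\
     g_mul G x (g_inv G x) = g_one G /\ g_mul G (g_inv G x) x = g_one G).

Definition grp_iso {T T'} (G : grp T) (G' : grp T') (nu : T -> T') : Prop :=
  (forall x, g_car G x -> g_car G' (nu x)) /\
  (forall x y, g_car G x -> g_car G y -> nu x = nu y -> x = y) /\
  (forall x', g_car G' x' -> exists x, g_car G x /\ nu x = x') /\
  (forall x y, g_car G x -> g_car G y -> nu (g_mul G x y) = g_mul G' (nu x) (nu y)).

Definition sigma {T} (S : sgrp T) (s t : T) : Prop :=
  s_car S s /\ s_car S t /\ exists e, idem S e /\ s_mul S e s = s_mul S e t.

(* elements of G(S) are the sigma-classes, viewed as predicates on T *)
Definition GS {T} (S : sgrp T) : grp (T -> Prop) :=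
  Grp (fun P => exists s, s_car S s /\ P = sigma S s)
      (fun P Q u => exists s t, P s /\ Q t /\ sigma S (s_mul S s t) u)
      (fun u => exists e, idem S e /\ sigma S e u)
      (fun P u => exists s, P s /\ sigma S (sinv S s) u).

Record tms (T A : Type) :=
  Tms { alpha : T -> A; lam : T -> A -> A; fco : T -> T -> A }.

Definition endo {A} (amul : A -> A -> A) (phi : A -> A) : Prop :=
  forall a b, phi (amul a b) = amul (phi a) (phi b).

Definition identity_of_image {A} (amul : A -> A -> A) (phi : A -> A) (e : A) : Prop :=
  (exists a, phi a = e) /\
  (forall a, amul e (phi a) = phi a /\ amul (phi a) e = phi a).

Definition rel_invertible {A} (amul : A -> A -> A) (phi : A -> A) : Prop :=
  endo amul phi /\
  exists (phib : A -> A) (e : A),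
    endo amul phib /\ idemA amul e /\
    (forall a, phib (phi a) = amul e a) /\
    (forall a, phi (phib a) = amul (phi e) a) /\
    identity_of_image amul phib e /\
    identity_of_image amul phi (phi e).

Definition idem_iso {T A} (S : sgrp T) (amul : A -> A -> A) (al : T -> A) : Prop :=
  (forall e, idem S e -> idemA amul (al e)) /\
  (forall e f, idem S e -> idem S f -> al e = al f -> e = f) /\
  (forall g, idemA amul g -> exists e, idem S e /\ al e = g) /\
  (forall e f, idem S e -> idem S f -> al (s_mul S e f) = amul (al e) (al f)).

Definition twisted_module {T A} (S : sgrp T) (amul : A -> A -> A) (L : tms T A) : Prop :=
  idem_iso S amul (alpha L) /\
  (forall s, s_car S s -> rel_invertible amul (lam L s)) /\
  (forall s t, s_car S s -> s_car S t ->
     Hgrp amul (alpha L (s_mul S (s_mul S (s_mul S s t) (sinv S t)) (sinv S s)))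
               (fco L s t)) /\
  (forall e a, idem S e -> lam L e a = amul (alpha L e) a) /\
  (forall s e, s_car S s -> idem S e ->
     lam L s (alpha L e) = alpha L (s_mul S (s_mul S s e) (sinv S s))) /\
  (forall s t a, s_car S s -> s_car S t ->
     lam L s (lam L t a) =
     amul (amul (fco L s t) (lam L (s_mul S s t) a)) (ainv amul (fco L s t))) /\
  (forall s e, s_car S s -> idem S e ->
     fco L (s_mul S s e) e = alpha L (s_mul S (s_mul S s e) (sinv S s)) /\
     fco L e (s_mul S e s) = alpha L (s_mul S (s_mul S e s) (sinv S s))) /\
  (forall s t u, s_car S s -> s_car S t -> s_car S u ->
     amul (lam L s (fco L t u)) (fco L s (s_mul S t u)) =
     amul (fco L s t) (fco L (s_mul S s t) u)).

Definition sieben_module {T A} (S : sgrp T) (amul : A -> A -> A) (L : tms T A) : Prop :=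
  twisted_module S amul L /\
  (forall s e, s_car S s -> idem S e ->
     fco L s e = alpha L (s_mul S (s_mul S s e) (sinv S s)) /\
     fco L e s = alpha L (s_mul S (s_mul S e s) (sinv S s))).

Definition tms_equiv {T A} (S : sgrp T) (amul : A -> A -> A) (L L' : tms T A) : Prop :=
  (forall e, idem S e -> alpha L' e = alpha L e) /\
  exists g : T -> A,
    (forall s, s_car S s -> Hgrp amul (alpha L (s_mul S s (sinv S s))) (g s)) /\
    (forall s a, s_car S s ->
       lam L' s a = amul (amul (g s) (lam L s a)) (ainv amul (g s))) /\
    (forall s t, s_car S s -> s_car S t ->
       amul (fco L' s t) (g (s_mul S s t)) =
       amul (amul (g s) (lam L s (g t))) (fco L s t)).

Definition tms_comp {T T' A} (L' : tms T' A) (nu : T -> T') : tms T A :=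
  Tms (fun s => alpha L' (nu s)) (fun s => lam L' (nu s))
      (fun s t => fco L' (nu s) (nu t)).

Definition tms_eq {T A} (S : sgrp T) (L L' : tms T A) : Prop :=
  (forall e, idem S e -> alpha L e = alpha L' e) /\
  (forall s a, s_car S s -> lam L s a = lam L' s a) /\
  (forall s t, s_car S s -> s_car S t -> fco L s t = fco L' s t).

(* a multiplier w is a pair (L, R): w s = fst w s, s w = snd w s *)
Definition mult (A : Type) : Type := ((A -> A) * (A -> A))%type.

Definition is_mult {A} (amul : A -> A -> A) (I : A -> Prop) (w : mult A) : Prop :=
  (forall s, I s -> I (fst w s) /\ I (snd w s)) /\
  (forall s t, I s -> I t -> fst w (amul s t) = amul (fst w s) t) /\
  (forall s t, I s -> I t -> snd w (amul s t) = amul s (snd w t)) /\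
  (forall s t, I s -> I t -> amul s (fst w t) = amul (snd w s) t).

(* w v = 1 = v w in M(I)  ((w v) s = w (v s), s (w v) = (s w) v) *)
Definition mult_inverse {A} (I : A -> Prop) (w v : mult A) : Prop :=
  forall s, I s ->
    fst w (fst v s) = s /\ fst v (fst w s) = s /\
    snd w (snd v s) = s /\ snd v (snd w s) = s.

Definition is_unit_mult {A} (amul : A -> A -> A) (I : A -> Prop) (w : mult A) : Prop :=
  is_mult amul I w /\ exists v, is_mult amul I v /\ mult_inverse I w v.

Definition minv {A} (amul : A -> A -> A) (I : A -> Prop) (w : mult A) : mult A :=
  epsilon (inhabits w) (fun v => is_mult amul I v /\ mult_inverse I w v).

Definition is_id_mult {A} (I : A -> Prop) (w : mult A) : Prop :=
  forall s, I s -> fst w s = s /\ snd w s = s.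

Definition mult_eq {A} (I : A -> Prop) (w w' : mult A) : Prop :=
  forall s, I s -> fst w s = fst w' s /\ snd w s = snd w' s.

Record tpa (TG A : Type) :=
  Tpa { D : TG -> A -> Prop; theta : TG -> A -> A; w : TG -> TG -> mult A }.

Definition setprod {A} (amul : A -> A -> A) (I J : A -> Prop) : A -> Prop :=
  fun c => exists a b, I a /\ J b /\ c = amul a b.

Definition ideal {A} (amul : A -> A -> A) (I : A -> Prop) : Prop :=
  (exists a, I a) /\ (forall a b, I b -> I (amul a b) /\ I (amul b a)).

Definition part_iso {A} (amul : A -> A -> A) (I J : A -> Prop) (f : A -> A) : Prop :=
  (forall a, I a -> J (f a)) /\
  (forall a b, I a -> I b -> f a = f b -> a = b) /\
  (forall b, J b -> exists a, I a /\ f a = b) /\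
  (forall a b, I a -> I b -> f (amul a b) = amul (f a) (f b)).

Definition twisted_partial_action {TG A} (G : grp TG) (amul : A -> A -> A)
    (P : tpa TG A) : Prop :=
  (forall x, g_car G x -> ideal amul (D P x)) /\
  (forall x, g_car G x -> part_iso amul (D P (g_inv G x)) (D P x) (theta P x)) /\
  (forall x y, g_car G x -> g_car G y ->
     is_unit_mult amul (setprod amul (D P x) (D P (g_mul G x y))) (w P x y)) /\
  (forall x, g_car G x -> seteq (setprod amul (D P x) (D P x)) (D P x)) /\
  (forall x y, g_car G x -> g_car G y ->
     seteq (setprod amul (D P x) (D P y)) (setprod amul (D P y) (D P x))) /\
  (forall a, D P (g_one G) a) /\
  (forall a, theta P (g_one G) a = a) /\
  (forall x y, g_car G x -> g_car G y ->
     seteq (image (theta P x) (setprod amul (D P (g_inv G x)) (D P y)))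
           (setprod amul (D P x) (D P (g_mul G x y)))) /\
  (forall x y s, g_car G x -> g_car G y ->
     setprod amul (D P (g_inv G y)) (D P (g_mul G (g_inv G y) (g_inv G x))) s ->
     theta P x (theta P y s) =
     snd (minv amul (setprod amul (D P x) (D P (g_mul G x y))) (w P x y))
         (fst (w P x y) (theta P (g_mul G x y) s))) /\
  (forall x, g_car G x ->
     is_id_mult (D P x) (w P (g_one G) x) /\ is_id_mult (D P x) (w P x (g_one G))) /\
  (forall x y z s, g_car G x -> g_car G y -> g_car G z ->
     setprod amul (setprod amul (D P (g_inv G x)) (D P y)) (D P (g_mul G y z)) s ->
     snd (w P x (g_mul G y z)) (theta P x (snd (w P y z) s)) =
     snd (w P (g_mul G x y) z) (snd (w P x y) (theta P x s))).

Definition tpa_equiv {TG A} (G : grp TG) (amul : A -> A -> A) (P P' : tpa TG A) : Prop :=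
  (forall x, g_car G x -> seteq (D P' x) (D P x)) /\
  exists eps : TG -> mult A,
    (forall x, g_car G x -> is_unit_mult amul (D P x) (eps x)) /\
    (forall x s, g_car G x -> D P (g_inv G x) s ->
       theta P' x s = snd (minv amul (D P x) (eps x)) (fst (eps x) (theta P x s))) /\
    (forall x y s, g_car G x -> g_car G y ->
       setprod amul (D P (g_inv G x)) (D P y) s ->
       snd (eps (g_mul G x y)) (snd (w P' x y) (theta P' x s)) =
       snd (w P x y) (fst (eps x) (theta P x (snd (eps y) s)))).

Definition tpa_comp {TG TG' A} (P' : tpa TG' A) (nu : TG -> TG') : tpa TG A :=
  Tpa (fun x => D P' (nu x)) (fun x => theta P' (nu x))
      (fun x y => w P' (nu x) (nu y)).

Definition tpa_eq {TG A} (G : grp TG) (amul : A -> A -> A) (P P' : tpa TG A) : Prop :=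
  forall x, g_car G x ->
    seteq (D P x) (D P' x) /\
    (forall a, D P (g_inv G x) a -> theta P x a = theta P' x a) /\
    (forall y, g_car G y ->
       mult_eq (setprod amul (D P x) (D P (g_mul G x y))) (w P x y) (w P' x y)).

Definition ThetaL {T A} (S : sgrp T) (amul : A -> A -> A) (L : tms T A)
    : tpa (T -> Prop) A :=
  Tpa
    (fun x a => exists s, x s /\ Hgrp amul (alpha L (s_mul S s (sinv S s))) a)
    (fun x a => epsilon (inhabits a) (fun b => exists s, x s /\
        alpha L (s_mul S (sinv S s) s) = amul a (ainv amul a) /\ b = lam L s a))
    (fun x y =>
       ((fun a => epsilon (inhabits a) (fun b => exists s t,
           x s /\ g_mul (GS S) x y t /\
           alpha L (s_mul S s (sinv S s)) = amul a (ainv amul a) /\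
           alpha L (s_mul S t (sinv S t)) = amul a (ainv amul a) /\
           b = amul (fco L s (s_mul S (sinv S s) t)) a)),
        (fun a => epsilon (inhabits a) (fun b => exists s t,
           x s /\ g_mul (GS S) x y t /\
           alpha L (s_mul S s (sinv S s)) = amul a (ainv amul a) /\
           alpha L (s_mul S t (sinv S t)) = amul a (ainv amul a) /\
           b = amul a (fco L s (s_mul S (sinv S s) t)))))).

Definition pinv {A} (I : A -> Prop) (f : A -> A) (b : A) : A :=
  epsilon (inhabits b) (fun a => I a /\ f a = b).

Definition theta_inv {TG A} (G : grp TG) (P : tpa TG A) (x : TG) : A -> A :=
  pinv (D P (g_inv G x)) (theta P x).

(* e delta_x is represented by the pair (e, x) *)
Definition EStar {TG A} (G : grp TG) (amul : A -> A -> A) (P : tpa TG A)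
    : sgrp (A * TG) :=
  Sgrp (fun p => g_car G (snd p) /\ idemA amul (fst p) /\ D P (snd p) (fst p))
       (fun p q => (theta P (snd p) (amul (theta_inv G P (snd p) (fst p)) (fst q)),
                    g_mul G (snd p) (snd q))).

Definition LambdaT {TG A} (G : grp TG) (amul : A -> A -> A) (P : tpa TG A)
    : tms (A * TG) A :=
  Tms (fun p => fst p)
      (fun p a => theta P (snd p) (amul (theta_inv G P (snd p) (fst p)) a))
      (fun p q => snd (w P (snd p) (snd q))
                    (theta P (snd p) (amul (theta_inv G P (snd p) (fst p)) (fst q)))).

(* Main.v *)
(* Every element a of a semilattice of groups lies in the group A_e with e = a a^-1,
   and on the local monoid e A a unit multiplier is translation by one element of A_e.
   So a twisted partial action is a compatible family of local data indexed by pairs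
   (e, x) with e an idempotent of D_x, which are the elements of E(A) * G.

   From a module over S, two sigma-related elements of the E-unitary S agree below
   their common range, so lambda_s a and f(s, t) a depend only on a and the classes of
   s and t as soon as the idempotents involved lie above a a^-1; the axioms of a twisted
   partial action then follow by choosing representatives with range exactly a a^-1.

   From a partial action, all axioms of a module come from one composition formula for
   the maps lambda_(e,x) a = theta_x(theta_(x^-1)(e) a). The twist disappears on
   idempotents because they are central, so theta is untwisted there. *)
From Stdlib Require Import ssreflect ClassicalEpsilon FunctionalExtensionality PropExtensionality.
Require Import Defs.

Set Implicit Arguments.
Unset Strict Implicit.

(* The Sieben condition acts through the cocycle identity: once f(e, s) and f(s, e) are trivial, it
   yields f(es, t) = α(e) f(s, t) and f(s, eu) = f(se, u). So f respects the natural order, and this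
   is what permits exchanging σ-related arguments of f.

   On the action side the obstacle is that θ_{x^-1} and the inverse of θ_x differ by a conjugation.
   They agree on idempotents, so θ_{x^-1}(e) can stand for θ_x^{-1}(e) in every formula; only the
   relative inverse of λ_{eδ_x} has to be built from the true inverse of θ_x.

   [ThetaL], [minv] and [theta_inv] are defined by choice. Each gets a description free of choice,
   and for [ThetaL] this holds for every representative lying above the element at hand, not only
   for the unique exact one; that freedom lets several elements be handled with matching
   representatives. *)
Create HintDb car.

Existing Class inverse_semigroup.
Existing Class E_unitary.
Existing Class semilattice_of_groups.

(* Membership of products and inverses in a carrier is left to the database [car]. *)
Ltac done ::=
  solve [ trivial | reflexivity | auto 7 with car | split; auto 7 with car
        | symmetry; trivial ].

(** * Inverse semigroups *)

(* Sealed, so that associativity rewriting does not unfold these idempotents. *)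
Fact rng_key : unit. Proof. exact tt. Qed.
Definition rng {T} (S : sgrp T) s := locked_with rng_key (s_mul S s (sinv S s)).
Definition dom {T} (S : sgrp T) s := locked_with rng_key (s_mul S (sinv S s) s).

Lemma rngE {T} (S : sgrp T) s : rng S s = s_mul S s (sinv S s).
Proof. by rewrite /rng unlock. Qed.

Lemma domE {T} (S : sgrp T) s : dom S s = s_mul S (sinv S s) s.
Proof. by rewrite /dom unlock. Qed.

Section InverseSemigroup.

Context {T : Type} {S : sgrp T}.

Local Notation car := (s_car S).
Local Notation idm := (idem S).
Local Notation "s · t" := (s_mul S s t) (at level 40, left associativity).
Local Notation inv := (sinv S).
Local Notation rng := (rng S).
Local Notation dom := (dom S).

Lemma idem_car e : idm e -> car e.
Proof. by case. Qed.

Lemma idem_mul e : idm e -> e · e = e.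
Proof. by case. Qed.

Hint Immediate idem_car : car.

Context {HS : inverse_semigroup S}.

Lemma mul_car s t : car s -> car t -> car (s · t).
Proof. by case: HS => -[H _] _; apply: H. Qed.

Lemma mulA s t u : car s -> car t -> car u -> s · t · u = s · (t · u).
Proof. by case: HS => -[_ H] _; apply: H. Qed.

Lemma car_inhabited : exists s, car s.
Proof. by case: HS => _ []. Qed.

Lemma inv_spec s : car s -> is_inverse_of S s (inv s).
Proof.
case: HS => _ [_ H] cs; rewrite /sinv; apply: epsilon_spec.
by case: (H s cs) => y [Hy _]; exists y.
Qed.

Lemma inv_uniq s t : car s -> is_inverse_of S s t -> inv s = t.
Proof.
move=> cs Ht; case: HS => _ [_ H]; case: (H s cs) => y [_ Hy].
by rewrite -(Hy _ Ht) (Hy _ (inv_spec cs)).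
Qed.

Lemma inv_car s : car s -> car (inv s).
Proof. by move=> /inv_spec []. Qed.

Hint Resolve mul_car inv_car : car.

Lemma mul_inv_mul s : car s -> s · inv s · s = s.
Proof. by move=> /inv_spec [_ []]. Qed.

Lemma inv_mul_inv s : car s -> inv s · s · inv s = inv s.
Proof. by move=> /inv_spec [_ []]. Qed.

Lemma inv_inv s : car s -> inv (inv s) = s.
Proof.
move=> cs; apply: inv_uniq => //.
by split=> //; split; [exact: inv_mul_inv | exact: mul_inv_mul].
Qed.

Lemma inv_idem e : idm e -> inv e = e.
Proof. by move=> He; apply: inv_uniq => //; split=> //; rewrite !(idem_mul He). Qed.

Lemma idem_mulK e s : idm e -> car s -> e · (e · s) = e · s.
Proof. by move=> He cs; rewrite -mulA // idem_mul. Qed.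

(** Let x be the inverse of ef. Then fxe is an inverse of ef too, so x = fxe by uniqueness. This
    form makes x idempotent, hence its own inverse, and therefore equal to ef. *)
Lemma idem_mul_idem e f : idm e -> idm f -> idm (e · f).
Proof.
move=> He Hf; set x := inv (e · f).
have cx : car x by rewrite /x.
have Hx : e · (f · (x · (e · f))) = e · f.
  by move: (mul_inv_mul (s := e · f)); rewrite -/x ?mulA //; apply.
have Hx' : x · (e · (f · x)) = x.
  by move: (inv_mul_inv (s := e · f)); rewrite -/x ?mulA //; apply.
have Hx2 : x · (e · (f · (x · e))) = x · e by rewrite -{3}Hx' ?mulA.
have ex : x = f · x · e.
  apply: inv_uniq => //; split=> //; split.
    by rewrite ?mulA // ?(idem_mulK Hf) // ?(idem_mulK He) // ?mulA.
  rewrite ?mulA // ?(idem_mulK Hf) // ?(idem_mulK He) //.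
  by rewrite Hx2.
have ix : idm x.
  split=> //; have {1}-> := ex; have {2}-> := ex.
  by rewrite {3}ex ?mulA // Hx2.
have <- : inv x = e · f by rewrite inv_inv //.
by rewrite inv_idem.
Qed.

Hint Resolve idem_mul_idem : car.

(** The idempotent ef is its own inverse, and fe is another inverse of it. *)
Lemma idem_comm e f : idm e -> idm f -> e · f = f · e.
Proof.
move=> He Hf; rewrite -(inv_idem (idem_mul_idem He Hf)); apply: inv_uniq => //.
have key g h : idm g -> idm h -> g · h · (h · g) · (g · h) = g · h.
  move=> Hg Hh; rewrite ?mulA // (idem_mulK Hh) // (idem_mulK Hg) //.
  by rewrite -{2}(idem_mul (idem_mul_idem Hg Hh)) ?mulA.
by split=> //; split; apply: key.
Qed.

Lemma rng_idem s : car s -> idm (rng s).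
Proof. by move=> cs; rewrite rngE; split=> //; rewrite -mulA // mul_inv_mul. Qed.

Lemma dom_idem s : car s -> idm (dom s).
Proof. by move=> cs; rewrite domE; split=> //; rewrite -mulA // inv_mul_inv. Qed.

Lemma rng_car s : car s -> car (rng s).
Proof. by move=> /rng_idem. Qed.

Lemma dom_car s : car s -> car (dom s).
Proof. by move=> /dom_idem. Qed.

Hint Resolve rng_idem dom_idem rng_car dom_car : car.

Lemma rng_mul_self s : car s -> rng s · s = s.
Proof. by rewrite rngE; apply: mul_inv_mul. Qed.

Lemma mul_dom_self s : car s -> s · dom s = s.
Proof. by move=> cs; rewrite domE -mulA // mul_inv_mul. Qed.

Lemma rng_inv s : car s -> rng (inv s) = dom s.
Proof. by move=> cs; rewrite rngE domE inv_inv. Qed.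

Lemma dom_inv s : car s -> dom (inv s) = rng s.
Proof. by move=> cs; rewrite rngE domE inv_inv. Qed.

Lemma rng_of_idem e : idm e -> rng e = e.
Proof. by move=> He; rewrite rngE inv_idem // idem_mul. Qed.

Lemma dom_of_idem e : idm e -> dom e = e.
Proof. by move=> He; rewrite domE inv_idem // idem_mul. Qed.

Lemma inv_mul s t : car s -> car t -> inv (s · t) = inv t · inv s.
Proof.
have key u v : car u -> car v -> u · v · (inv v · inv u) · (u · v) = u · v.
  move=> cu cv; transitivity (u · (rng v · dom u · v)).
    by rewrite rngE domE ?mulA.
  rewrite (idem_comm (rng_idem cv) (dom_idem cu)).
  by rewrite (@mulA (dom u)) // rng_mul_self // -mulA // mul_dom_self.
move=> cs ct; apply: inv_uniq => //; split=> //; split; first exact: key.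
by move: (key (inv t) (inv s)); rewrite !inv_inv //; apply.
Qed.

Lemma rng_mul s t : car s -> car t -> rng (s · t) = s · rng t · inv s.
Proof. by move=> cs ct; rewrite !rngE inv_mul // ?mulA. Qed.

Lemma dom_mul s t : car s -> car t -> dom (s · t) = inv t · dom s · t.
Proof. by move=> cs ct; rewrite !domE inv_mul // ?mulA. Qed.

Lemma rng_mulE s t : car s -> car t -> rng (s · t) = s · t · inv t · inv s.
Proof. by move=> cs ct; rewrite rngE inv_mul // ?mulA. Qed.

Lemma rng_mul_idem s e : car s -> idm e -> rng (s · e) = s · e · inv s.
Proof. by move=> cs He; rewrite rng_mul // rng_of_idem. Qed.

Lemma rng_mul_rng s t : car s -> car t -> rng (s · rng t) = rng (s · t).
Proof. by move=> cs ct; rewrite rng_mul_idem // rng_mul. Qed.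

Lemma rng_idem_mul e s : idm e -> car s -> rng (e · s) = e · rng s.
Proof.
move=> He cs; rewrite rng_mul // inv_idem // (idem_comm He (rng_idem cs)) mulA //.
by rewrite idem_mul.
Qed.

Lemma rng_idem_mulE e s : idm e -> car s -> rng (e · s) = e · s · inv s.
Proof. by move=> He cs; rewrite rng_idem_mul // rngE mulA. Qed.

Lemma dom_mul_idem s e : car s -> idm e -> dom (s · e) = e · dom s.
Proof.
move=> cs He; rewrite dom_mul // inv_idem // (idem_comm He (dom_idem cs)) mulA //.
by rewrite idem_mul.
Qed.

(** The idempotent crosses [s] and becomes the conjugate s e s^{-1}. This moves one-sided conditions
    on idempotents, such as the one in [sigma], to the other side. *)
Lemma mul_idem_slide s e : car s -> idm e -> s · e = rng (s · e) · s.
Proof.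
move=> cs He; rewrite rng_mul_idem // (@mulA (s · e)) // -domE (@mulA s) //.
by rewrite (idem_comm He (dom_idem cs)) -mulA // mul_dom_self.
Qed.

Lemma rng_mul_le s t : car s -> car t -> rng s · rng (s · t) = rng (s · t).
Proof. by move=> cs ct; rewrite -rng_idem_mul // -mulA // rng_mul_self. Qed.

Lemma rng_mul_dom s : car s -> rng (s · dom s) = rng s.
Proof. by move=> cs; rewrite mul_dom_self. Qed.

(** * The congruence σ and its quotient group *)

Lemma sigma_refl s : car s -> sigma S s s.
Proof. by move=> cs; split=> //; split=> //; exists (rng s); split. Qed.

Lemma sigma_sym s t : sigma S s t -> sigma S t s.
Proof. by case=> cs [ct [e [He E]]]; split=> //; split=> //; exists e. Qed.

Lemma sigma_trans s t u : sigma S s t -> sigma S t u -> sigma S s u.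
Proof.
case=> cs [ct [e [He E]]] [_ [cu [f [Hf F]]]]; split=> //; split=> //.
exists (f · e); split=> //; rewrite mulA // E.
by rewrite (idem_comm Hf He) mulA // -F -!mulA // (idem_comm He Hf).
Qed.

Lemma sigma_mul s s' t t' :
  sigma S s s' -> sigma S t t' -> sigma S (s · t) (s' · t').
Proof.
case=> cs [cs' [e [He E]]] [ct [ct' [f [Hf F]]]].
apply: (@sigma_trans _ (s · t')); last first.
  by split=> //; split=> //; exists e; split=> //; rewrite -!mulA // E.
(* [sigma] only multiplies on the left, so the idempotent equalizing [t] and [t'] is slid through
   [s]. *)
split=> //; split=> //; exists (rng (s · f)); split=> //.
by rewrite -!mulA // -!mul_idem_slide // !mulA // F.
Qed.

Lemma sigma_inv s t : sigma S s t -> sigma S (inv s) (inv t).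
Proof.
case=> cs [ct [e [He E]]].
have E' : inv s · e = inv t · e by rewrite -{1}(inv_idem He) -inv_mul // E inv_mul // (inv_idem He).
apply: (@sigma_trans _ (inv s · e)).
  split=> //; split=> //; exists (rng (inv s · e)); split=> //.
  by rewrite -mul_idem_slide // rng_mul_self.
rewrite E'; split=> //; split=> //; exists (rng (inv t · e)); split=> //.
by rewrite -mul_idem_slide // rng_mul_self.
Qed.

Lemma sigma_idem e f : idm e -> idm f -> sigma S e f.
Proof.
move=> He Hf; split=> //; split=> //; exists (e · f); split=> //.
by rewrite (idem_comm He Hf) mulA // idem_mul // -(idem_comm He Hf) mulA // idem_mul.
Qed.

Lemma sigma_class s t : sigma S s t -> sigma S s = sigma S t.
Proof.
move=> st; apply: functional_extensionality => u; apply: propositional_extensionality.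
by split=> H; [apply: sigma_trans H; apply: sigma_sym | apply: sigma_trans H].
Qed.

Lemma GS_car_class s : car s -> g_car (GS S) (sigma S s).
Proof. by move=> cs; exists s. Qed.

Lemma class_of_mem x s : g_car (GS S) x -> x s -> x = sigma S s.
Proof. by case=> t [ct ->] /sigma_class. Qed.

Lemma car_of_mem x s : g_car (GS S) x -> x s -> car s.
Proof. by case=> t [ct ->] [_ []]. Qed.

Lemma class_inhabited x : g_car (GS S) x -> exists s, x s.
Proof. by case=> s [cs ->]; exists s; apply: sigma_refl. Qed.

Lemma class_sigma x s t : g_car (GS S) x -> x s -> x t -> sigma S s t.
Proof. by move=> gx xs; rewrite (class_of_mem gx xs). Qed.

Lemma class_sigma_mem x s t : g_car (GS S) x -> x s -> sigma S s t -> x t.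
Proof. by move=> gx xs; rewrite (class_of_mem gx xs). Qed.

Lemma GS_mulE s t : car s -> car t ->
  g_mul (GS S) (sigma S s) (sigma S t) = sigma S (s · t).
Proof.
move=> cs ct; apply: functional_extensionality => u.
apply: propositional_extensionality; split=> /=.
  by case=> s' [t' [ss [tt H]]]; apply: sigma_trans H; apply: sigma_mul.
by move=> H; exists s, t; split; [|split=> //]; apply: sigma_refl.
Qed.

Lemma GS_oneE e : idm e -> g_one (GS S) = sigma S e.
Proof.
move=> He; apply: functional_extensionality => u.
apply: propositional_extensionality; split=> /=.
  by case=> f [Hf]; apply: sigma_trans; apply: sigma_idem.
by move=> H; exists e.
Qed.

Lemma GS_invE s : car s -> g_inv (GS S) (sigma S s) = sigma S (inv s).
Proof.
move=> cs; apply: functional_extensionality => u.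
apply: propositional_extensionality; split=> /=.
  by case=> t [st H]; apply: sigma_trans H; apply: sigma_inv.
by move=> H; exists s; split=> //; apply: sigma_refl.
Qed.

Lemma GS_mul_mem x y s t :
  g_car (GS S) x -> g_car (GS S) y -> x s -> y t -> g_mul (GS S) x y (s · t).
Proof.
move=> gx gy xs yt; have cs := car_of_mem gx xs; have ct := car_of_mem gy yt.
rewrite (class_of_mem gx xs) (class_of_mem gy yt) GS_mulE //.
by apply: sigma_refl => //.
Qed.

Lemma GS_inv_mem x s : g_car (GS S) x -> x s -> g_inv (GS S) x (inv s).
Proof.
move=> gx xs; have cs := car_of_mem gx xs.
by rewrite (class_of_mem gx xs) GS_invE //; apply: sigma_refl => //.
Qed.

Lemma GS_one_mem e : idm e -> g_one (GS S) e.
Proof. by move=> He; rewrite (GS_oneE He); apply: sigma_refl => //. Qed.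

Lemma sigma_idem_mul e s : idm e -> car s -> sigma S (e · s) s.
Proof.
by move=> He cs; split=> //; split=> //; exists e; split=> //; rewrite idem_mulK.
Qed.

Lemma sigma_mul_idem e s : idm e -> car s -> sigma S (s · e) s.
Proof.
move=> He cs; apply: (@sigma_trans _ (s · dom s)).
  by apply: sigma_mul; [apply: sigma_refl | apply: sigma_idem => //].
by rewrite mul_dom_self //; apply: sigma_refl.
Qed.

Lemma class_idem_mul x e s : g_car (GS S) x -> x s -> idm e -> x (e · s).
Proof.
move=> gx xs He; apply: (class_sigma_mem gx xs).
by apply/sigma_sym/sigma_idem_mul => //; apply: car_of_mem xs.
Qed.

Lemma class_mul_idem x e s : g_car (GS S) x -> x s -> idm e -> x (s · e).
Proof.
move=> gx xs He; apply: (class_sigma_mem gx xs).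
by apply/sigma_sym/sigma_mul_idem => //; apply: car_of_mem xs.
Qed.

Lemma GS_mul_car x y :
  g_car (GS S) x -> g_car (GS S) y -> g_car (GS S) (g_mul (GS S) x y).
Proof.
by move=> [s [cs ->]] [t [ct ->]]; rewrite GS_mulE //; apply: GS_car_class => //.
Qed.

Lemma GS_inv_car x : g_car (GS S) x -> g_car (GS S) (g_inv (GS S) x).
Proof. by move=> [s [cs ->]]; rewrite GS_invE //; apply: GS_car_class => //. Qed.

Lemma GS_one_car : g_car (GS S) (g_one (GS S)).
Proof.
case: car_inhabited => s cs.
by rewrite (GS_oneE (rng_idem cs)); apply: GS_car_class => //.
Qed.

(** Places the second argument of f(s, s^{-1}t), as it occurs in the definition of the twist, in the
    class [y]. *)
Lemma class_divl x y s t : g_car (GS S) x -> g_car (GS S) y ->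
  x s -> g_mul (GS S) x y t -> y (inv s · t).
Proof.
move=> gx gy xs xyt; have [u yu] := class_inhabited gy.
have cs := car_of_mem gx xs; have cu := car_of_mem gy yu.
apply: (class_sigma_mem gy yu); apply: (@sigma_trans _ (dom s · u)).
  by apply/sigma_sym/sigma_idem_mul.
rewrite domE mulA //; apply: sigma_mul; first by apply: sigma_refl => //.
by apply: (class_sigma (GS_mul_car gx gy)) => //; apply: GS_mul_mem.
Qed.

Lemma class_divr x y s t : g_car (GS S) x -> g_car (GS S) y ->
  y t -> g_mul (GS S) x y s -> x (s · inv t).
Proof.
move=> gx gy yt xys; have [u xu] := class_inhabited gx.
have ct := car_of_mem gy yt; have cu := car_of_mem gx xu.
apply: (class_sigma_mem gx xu); apply: (@sigma_trans _ (u · rng t)).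
  by apply/sigma_sym/sigma_mul_idem => //.
rewrite rngE -mulA //; apply: sigma_mul; last by apply: sigma_refl => //.
by apply: (class_sigma (GS_mul_car gx gy)) => //; apply: GS_mul_mem.
Qed.

Lemma GS_group : group (GS S).
Proof.
split; first exact: GS_mul_car.
split.
  move=> _ _ _ [s [cs ->]] [t [ct ->]] [u [cu ->]].
  by rewrite !GS_mulE // mulA.
split; first exact: GS_one_car.
split.
  move=> _ [s [cs ->]]; split.
    by rewrite (GS_oneE (rng_idem cs)) GS_mulE // rng_mul_self.
  by rewrite (GS_oneE (dom_idem cs)) GS_mulE // mul_dom_self.
move=> x gx; split; first exact: GS_inv_car.
case: gx => s [cs ->]; rewrite GS_invE // !GS_mulE //.
by rewrite -rngE -domE -(GS_oneE (rng_idem cs)) -(GS_oneE (dom_idem cs)).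
Qed.

(** * Compatibility of σ-related elements in an E-unitary semigroup *)

Section EUnitary.

Context {HU : E_unitary S}.

(** If f equalizes s and e, then the idempotent fe = fs lies below s. *)
Lemma idem_of_sigma s e : idm e -> sigma S s e -> idm s.
Proof.
move=> He [cs [_ [f [Hf E]]]]; apply: (HU (e := f · e)) => //.
by exists f; rewrite E.
Qed.

(** The element i = s^{-1}t is σ-related to t^{-1}t, hence idempotent. Now si is ss^{-1}t, and
    sliding i through s writes it as an idempotent multiple of s. This is the agreement of s and t
    below their common range. *)
Lemma sigma_rng s t : sigma S s t -> rng t · s = rng s · t.
Proof.
move=> H; have [cs [ct _]] := H.
have Hi : idm (inv s · t).
  apply: (idem_of_sigma (dom_idem ct)); rewrite domE; apply: sigma_mul.
    exact: sigma_inv.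
  by apply: sigma_refl.
have E : s · (inv s · t) = rng s · t by rewrite rngE -mulA.
rewrite -E (mul_idem_slide cs Hi) E rng_idem_mul // (idem_comm (rng_idem cs)) //.
by rewrite mulA // rng_mul_self.
Qed.

Lemma sigma_dom s t : sigma S s t -> s · dom t = t · dom s.
Proof.
move=> H; have [cs [ct _]] := H; move: (sigma_rng (sigma_inv H)).
rewrite !rng_inv // => /(f_equal inv).
by rewrite !inv_mul // !inv_inv // !inv_idem.
Qed.

Lemma sigma_eq_rng s t : sigma S s t -> rng s = rng t -> s = t.
Proof.
move=> H E; have [cs [ct _]] := H; move: (sigma_rng H).
by rewrite -{1}E {2}E !rng_mul_self.
Qed.

Lemma sigma_idem_eq s t e : sigma S s t -> idm e ->
  e · rng s = e -> e · rng t = e -> e · s = e · t.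
Proof.
move=> H He Es Et; have [cs [ct _]] := H.
by rewrite -{1}Et -{2}Es !mulA // sigma_rng.
Qed.

(** Both s^{-1}t and st^{-1} are idempotent, so each equals its own inverse. The idempotent st^{-1}
    lies below both ranges, so it has the same product with s as with t. *)
Lemma sigma_dom_rng s t : sigma S s t -> s · dom t = rng t · s.
Proof.
move=> H; have [cs [ct _]] := H; rewrite (sigma_rng H).
have Hi : idm (inv s · t).
  apply: (idem_of_sigma (dom_idem ct)); rewrite domE; apply: sigma_mul.
    exact: sigma_inv.
  by apply: sigma_refl.
have Hj : idm (s · inv t).
  apply: (idem_of_sigma (rng_idem ct)); rewrite rngE; apply: sigma_mul => //.
  by apply: sigma_refl => //.
have Ei : inv s · t = inv t · s by rewrite -(inv_idem Hi) inv_mul // inv_inv.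
have Ej : s · inv t = t · inv s by rewrite -(inv_idem Hj) inv_mul // inv_inv.
rewrite domE rngE mulA // Ei -!mulA //; symmetry; apply: sigma_idem_eq => //.
  by rewrite (idem_comm Hj) // -mulA // rng_mul_self.
by rewrite (idem_comm Hj) // Ej -mulA // rng_mul_self.
Qed.

End EUnitary.

End InverseSemigroup.

#[export] Hint Immediate idem_car : car.
#[export] Hint Resolve mul_car inv_car idem_mul_idem rng_idem dom_idem rng_car dom_car : car.

(** If t and u are inverses of s, the idempotents ts and us absorb one another and commute, so ts =
    us; likewise st = su. Then t = tst = ust = usu = u. *)
Lemma inverse_semigroup_of_comm_idem {T} (S : sgrp T) :
  closed_assoc S -> (exists s, s_car S s) ->
  (forall s, s_car S s -> exists t, is_inverse_of S s t) ->
  (forall e f, idem S e -> idem S f -> s_mul S e f = s_mul S f e) ->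
  inverse_semigroup S.
Proof.
move=> CA ne ex comm; split=> //; split=> // s cs; have [t Ht] := ex s cs.
exists t; split=> // u Hu; case: CA => C A.
case: Ht Hu => [ct [E1 E2]] [cu [E3 E4]].
have [c1 [c2 [c3 c4]]] : s_car S (s_mul S t s) /\ s_car S (s_mul S u s) /\
  s_car S (s_mul S s t) /\ s_car S (s_mul S s u).
  by split; [|split; [|split]]; apply: C.
have i1 : idem S (s_mul S t s) by split=> //; rewrite -A // E2.
have i2 : idem S (s_mul S u s) by split=> //; rewrite -A // E4.
have i3 : idem S (s_mul S s t) by split=> //; rewrite -A // E1.
have i4 : idem S (s_mul S s u) by split=> //; rewrite -A // E3.
have e1 : s_mul S t s = s_mul S u s.
  have F1 : s_mul S (s_mul S t s) (s_mul S u s) = s_mul S t s by rewrite A // -(A s) // E3.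
  have F2 : s_mul S (s_mul S u s) (s_mul S t s) = s_mul S u s by rewrite A // -(A s) // E1.
  by rewrite -F1 comm.
have e2 : s_mul S s t = s_mul S s u.
  have F1 : s_mul S (s_mul S s t) (s_mul S s u) = s_mul S s u by rewrite -A // E1.
  have F2 : s_mul S (s_mul S s u) (s_mul S s t) = s_mul S s t by rewrite -A // E3.
  by rewrite -F2 comm.
by rewrite -E2 e1 A // e2 -A // E4.
Qed.

(** * Groups *)

Existing Class group.

Section Group.

Context {TG : Type} {G : grp TG} {HG : group G}.

Local Notation car := (g_car G).
Local Notation "x ⋆ y" := (g_mul G x y) (at level 40, left associativity).
Local Notation inv := (g_inv G).
Local Notation one := (g_one G).

Lemma gmul_car x y : car x -> car y -> car (x ⋆ y).
Proof. by case: HG => H _; apply: H. Qed.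

Lemma ginv_car x : car x -> car (inv x).
Proof. by case: HG => _ [_ [_ [_ H]]] /H []. Qed.

Lemma gone_car : car one.
Proof. by case: HG => _ [_ []]. Qed.

Hint Resolve gmul_car ginv_car gone_car : car.

Lemma gmulA x y z : car x -> car y -> car z -> x ⋆ y ⋆ z = x ⋆ (y ⋆ z).
Proof. by case: HG => _ [H _]; apply: H. Qed.

Lemma gmul1 x : car x -> x ⋆ one = x.
Proof. by case: HG => _ [_ [_ [H _]]] /H []. Qed.

Lemma g1mul x : car x -> one ⋆ x = x.
Proof. by case: HG => _ [_ [_ [H _]]] /H []. Qed.

Lemma gmulV x : car x -> x ⋆ inv x = one.
Proof. by case: HG => _ [_ [_ [_ H]]] /H [_ []]. Qed.

Lemma gVmul x : car x -> inv x ⋆ x = one.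
Proof. by case: HG => _ [_ [_ [_ H]]] /H [_ []]. Qed.

Lemma gVmulK x y : car x -> car y -> inv x ⋆ (x ⋆ y) = y.
Proof. by move=> cx cy; rewrite -gmulA // gVmul // g1mul. Qed.

Lemma gmulKV x y : car x -> car y -> x ⋆ y ⋆ inv y = x.
Proof. by move=> cx cy; rewrite gmulA // gmulV // gmul1. Qed.

Lemma ginv_inv x : car x -> inv (inv x) = x.
Proof. by move=> cx; rewrite -[RHS](gVmulK (ginv_car cx)) // gVmul // gmul1. Qed.

Lemma ginv_mul x y : car x -> car y -> inv (x ⋆ y) = inv y ⋆ inv x.
Proof.
move=> cx cy; rewrite -[RHS](@gVmulK (x ⋆ y)) //.
by rewrite -(@gmulA _ (inv y)) // gmulKV // gmulV // gmul1.
Qed.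

Lemma gmul_idem x : car x -> x ⋆ x = x -> x = one.
Proof. by move=> cx E; rewrite -(gVmul cx) -{3}E gVmulK. Qed.

Lemma ginv_one : inv one = one.
Proof. by apply: gmul_idem => //; rewrite -ginv_mul // gmul1. Qed.

End Group.

#[export] Hint Resolve gmul_car ginv_car gone_car : car.

(** * Semilattices of groups and their multipliers *)

Definition supp {A} (amul : A -> A -> A) a := rng (full_sgrp amul) a.

(* On the local submonoid [e A] a unit multiplier is translation by a single
   element [c] invertible there. *)
Definition acts {A} (amul : A -> A -> A) (w : mult A) e c :=
  amul (supp amul c) e = e /\
  forall b, amul e b = b -> fst w b = amul c b /\ snd w b = amul b c.

Section Clifford.

Context {A : Type} {amul : A -> A -> A} {HA : semilattice_of_groups amul}.

Local Notation "a * b" := (amul a b).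
Local Notation "a ^-1" := (ainv amul a) (at level 3, left associativity, format "a ^-1").
Local Notation supp := (supp amul).
Local Notation idm := (idemA amul).
Local Notation acts := (acts amul).

#[export] Instance Clifford_inverse_semigroup : inverse_semigroup (full_sgrp amul).
Proof. by case: HA. Qed.

Implicit Types a b c e f : A.

Lemma amulA a b c : a * b * c = a * (b * c).
Proof. exact: (@mulA A (full_sgrp amul)). Qed.

Lemma idem_central e a : idm e -> e * a = a * e.
Proof. by case: HA => _; apply. Qed.

Lemma idemM e : idm e -> e * e = e.
Proof. by case. Qed.

Lemma idemA_intro e : e * e = e -> idm e.
Proof. by move=> E; exact: (conj I E). Qed.

Lemma idemK e a : idm e -> e * (e * a) = e * a.
Proof. by move=> He; rewrite -amulA idemM. Qed.

Lemma idemA_mul e f : idm e -> idm f -> idm (e * f).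
Proof. exact: idem_mul_idem. Qed.

Lemma supp_idem a : idm (supp a).
Proof. exact: rng_idem. Qed.

Hint Resolve supp_idem idemA_mul : car.

Lemma suppK a : supp a * a = a.
Proof. exact: (@rng_mul_self A (full_sgrp amul)). Qed.

Lemma mul_supp a : a * supp a = a.
Proof. by rewrite -idem_central // suppK. Qed.

Lemma mulaV a : a * a^-1 = supp a.
Proof. by rewrite /supp rngE. Qed.

Lemma ainv_ainv a : a^-1^-1 = a.
Proof. exact: inv_inv. Qed.

Lemma ainv_idem e : idm e -> e^-1 = e.
Proof. exact: inv_idem. Qed.

(** Since idempotents are central, aa^{-1} and a^{-1}a absorb each other. *)
Lemma mulVa a : a^-1 * a = supp a.
Proof.
have iq : idm (a^-1 * a).
  have <- : dom (full_sgrp amul) a = a^-1 * a by rewrite domE.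
  exact: dom_idem.
have E1 : a * (a^-1 * a) = a by rewrite -amulA mulaV suppK.
have E2 : supp a = a^-1 * a * supp a.
  by rewrite -mulaV -{1}E1 -(idem_central a iq) amulA.
have E3 : a^-1 * a = a^-1 * a * supp a by rewrite amulA mul_supp.
by rewrite E3 -E2.
Qed.

Lemma supp_ainv a : supp a^-1 = supp a.
Proof. by rewrite -mulaV ainv_ainv mulVa. Qed.

Lemma ainv_mul a b : (a * b)^-1 = b^-1 * a^-1.
Proof. exact: (@inv_mul A (full_sgrp amul)). Qed.

Lemma supp_mul a b : supp (a * b) = supp a * supp b.
Proof.
rewrite -mulaV ainv_mul amulA -(amulA b) mulaV -amulA.
by rewrite -(idem_central a (supp_idem b)) amulA mulaV idem_central.
Qed.

Lemma supp_of_idem e : idm e -> supp e = e.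
Proof. exact: rng_of_idem. Qed.

Lemma supp_supp a : supp (supp a) = supp a.
Proof. exact: supp_of_idem. Qed.

Lemma ainv_supp a : (supp a)^-1 = supp a.
Proof. exact: ainv_idem. Qed.

Lemma HgrpE e a : Hgrp amul e a <-> supp a = e.
Proof. by rewrite /Hgrp mulaV mulVa; split=> [[]|->]. Qed.

Lemma supp_le e a : idm e -> e * a = a -> e * supp a = supp a.
Proof. by move=> He E; rewrite -{2}E supp_mul (supp_of_idem He). Qed.

Lemma ainv_uniq a b : a * b * a = a -> b * a * b = b -> a^-1 = b.
Proof. by move=> H1 H2; apply: inv_uniq => //; split. Qed.

Lemma conj_supp c a : supp c * a = a -> c * (c^-1 * a) = a.
Proof. by move=> E; rewrite -amulA mulaV. Qed.

Lemma conjV_supp c a : supp c * a = a -> c^-1 * (c * a) = a.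
Proof. by move=> E; rewrite -amulA mulVa. Qed.

Lemma conj_idem c e : idm e -> supp c * e = e -> c * e * c^-1 = e.
Proof. by move=> He E; rewrite -(idem_central c He) amulA mulaV idem_central. Qed.

Lemma idem_group_elt e : e * e = e -> supp e = e.
Proof. by move=> E; apply/supp_of_idem/idemA_intro. Qed.

Lemma endo_supp phi : endo amul phi -> forall a, supp (phi a) = phi (supp a).
Proof.
move=> Hp a; rewrite -!mulaV Hp; congr (_ * _); apply: ainv_uniq.
  by rewrite -!Hp mulaV suppK.
by rewrite -!Hp mulVa -supp_ainv suppK.
Qed.

Section Ideals.

Context (I J : A -> Prop) {HI : ideal amul I} {HJ : ideal amul J}.

Lemma ideal_mull a b : I b -> I (a * b).
Proof. by case: HI => _ H Hb; case: (H a b Hb). Qed.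

Lemma ideal_mulr a b : I a -> I (a * b).
Proof. by case: HI => _ H Ha; case: (H b a Ha). Qed.

Lemma ideal_le e a : I e -> e * a = a -> I a.
Proof. by move=> H <-; apply: ideal_mulr. Qed.

Lemma ideal_supp a : I a -> I (supp a).
Proof. by move=> H; rewrite -mulaV; apply: ideal_mulr. Qed.

(** Regularity turns products of ideals into intersections: a = (aa^{-1})a splits a common element
    into a factor in each ideal. *)
Lemma setprodE a : setprod amul I J a <-> I a /\ J a.
Proof.
split=> [[b [c [Ib [Jc ->]]]]|[Ia Ja]].
  split; first exact: ideal_mulr.
  by case: HJ => _ H; case: (H b c Jc).
by exists (supp a), a; rewrite suppK; split=> //; apply: ideal_supp.
Qed.

Lemma ideal_setprod : ideal amul (setprod amul I J).
Proof.
split.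
  case: HI => [[a Ia] _]; case: HJ => [[b Jb] _].
  by exists (a * b), a, b.
case: HJ => _ HJ' a b /setprodE [Ib Jb]; split; apply/setprodE; split.
- exact: ideal_mull.
- by case: (HJ' a b Jb).
- exact: ideal_mulr.
- by case: (HJ' a b Jb).
Qed.

End Ideals.

Lemma actsL w e c b : acts w e c -> e * b = b -> fst w b = c * b.
Proof. by case=> _ H /H []. Qed.

Lemma actsR w e c b : acts w e c -> e * b = b -> snd w b = b * c.
Proof. by case=> _ H /H []. Qed.

Section UnitMultipliers.

Context (I : A -> Prop) {HI : ideal amul I}.

(** Centrality of e together with the linking axiom of multipliers gives we = ew, and this element c
    acts on both sides of every b = eb. The inverse multiplier supplies some d with dc = e, which
    forces the support of c to be all of e. *)
Lemma unit_mult_acts w e : is_unit_mult amul I w -> I e -> idm e ->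
  supp (snd w e) = e /\ acts w e (snd w e).
Proof.
case=> [[cl [wl [wr lr]]] [v [[vcl [vl [vr vlr]]] inv]]] Ie He.
have E1 : fst w e = e * fst w e by rewrite idem_central // -wl // idemM.
have E2 : snd w e = e * snd w e by rewrite -wr // idemM.
have V2 : snd v e = e * snd v e by rewrite -vr // idemM.
have E : fst w e = snd w e.
  by rewrite E1 lr // -idem_central.
have loc b : e * b = b -> fst w b = snd w e * b /\ snd w b = b * snd w e.
  move=> Eb; have Ib : I b by apply: (ideal_le Ie).
  split; first by rewrite -{1}Eb wl // E.
  by rewrite -{1}Eb idem_central // wr.
have sE : snd v e * snd w e = e.
  have [_ [_ [H _]]] := inv e Ie; rewrite -[RHS]H.
  by case: (loc (snd v e)) => [|_ ->].
have s1 : supp (snd w e) = e.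
  have s2 : e * supp (snd w e) = supp (snd w e) by apply: supp_le.
  have s3 : supp (snd v e) * supp (snd w e) = e.
    by rewrite -supp_mul sE supp_of_idem.
  by rewrite -s2 -{1}s3 amulA idemM.
by split=> //; split=> //; rewrite s1 idemM.
Qed.

Lemma minv_spec w : is_unit_mult amul I w ->
  is_mult amul I (minv amul I w) /\ mult_inverse I w (minv amul I w).
Proof.
by case=> _; apply: (epsilon_spec _ (fun v => is_mult amul I v /\ mult_inverse I w v)).
Qed.

(** [minv] is only known through w(vb) = b and (bv)w = b. As w translates by c below e, cancelling c
    there identifies v as translation by its inverse. *)
Lemma minv_acts w e c : is_unit_mult amul I w -> I e -> idm e ->
  acts w e c -> acts (minv amul I w) e c^-1.
Proof.
move=> Hw Ie He Ha; have [[vcl [vl [vr vlr]]] inv] := minv_spec Hw.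
have [sc _] := Ha; split; first by rewrite supp_ainv.
move=> b Eb; have Ib : I b by apply: (ideal_le Ie).
have Eb' : b * e = b by rewrite -idem_central.
have [H1 [_ [H3 _]]] := inv b Ib.
have el : e * fst (minv amul I w) b = fst (minv amul I w) b.
  by rewrite idem_central // -vl // Eb'.
have er : e * snd (minv amul I w) b = snd (minv amul I w) b by rewrite -vr // Eb.
move: H1 H3; rewrite (actsL Ha el) (actsR Ha er) => H1 H3; split.
  by rewrite -{2}H1 conjV_supp // -el -amulA sc.
rewrite -{2}H3 amulA mulaV -idem_central //.
by rewrite -er -amulA sc.
Qed.

(** The delicate axiom is sL(t) = R(s)t, because s and t come with different translating elements.
    Evaluating [u] on the idempotent [supp s * supp t] shows that these agree there, and s x t only
    sees x through that idempotent. *)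
Lemma is_mult_of_local u :
  (forall a, I a -> exists c, supp c * supp a = supp a /\
     forall b, supp a * b = b -> fst u b = c * b /\ snd u b = b * c) ->
  is_mult amul I u.
Proof.
move=> Hu; split; [|split; [|split]].
- move=> s Is; have [c [_ Hc]] := Hu s Is.
  by have [-> ->] := Hc s (suppK s); split; [apply: ideal_mull | apply: ideal_mulr].
- move=> s t Is It; have [c [_ Hc]] := Hu s Is.
  have [-> _] := Hc s (suppK s).
  have [|-> _] := Hc (s * t); first by rewrite -amulA suppK.
  by rewrite amulA.
- move=> s t Is It; have [c [_ Hc]] := Hu t It.
  have [_ ->] := Hc t (suppK t).
  have [|_ ->] := Hc (s * t); last by rewrite amulA.
  by rewrite -amulA (idem_central s) // amulA suppK.
- move=> s t Is It; have [c [_ Hc]] := Hu s Is; have [d' [_ Hd]] := Hu t It.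
  have [_ ->] := Hc s (suppK s); have [-> _] := Hd t (suppK t).
  have E1 : supp s * (supp s * supp t) = supp s * supp t by apply: idemK.
  have E2 : supp t * (supp s * supp t) = supp s * supp t.
    by rewrite -idem_central // amulA idemM.
  have [F _] := Hc _ E1; have [F' _] := Hd _ E2.
  have K x : s * x * t = s * (x * (supp s * supp t)) * t.
    rewrite -(amulA x) -(idem_central x (supp_idem s)) -{1}(mul_supp s) -{1}(suppK t).
    by rewrite !amulA.
  by rewrite -amulA K -F' F -K.
Qed.

Lemma is_unit_multP w :
  (forall e, I e -> idm e -> exists c, acts w e c) -> is_unit_mult amul I w.
Proof.
move=> H.
have loc a : I a -> exists c, supp c * supp a = supp a /\
    forall b, supp a * b = b -> fst w b = c * b /\ snd w b = b * c.
  by move=> Ia; apply: H => //; apply: ideal_supp.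
(* On the idempotent [supp a] the multiplier [w] returns its own translating element cut down to
   that support, so its inverse can be written without choosing c. *)
pose v : mult A := (fun a => (fst w (supp a))^-1 * a, fun a => a * (fst w (supp a))^-1).
have vloc a c b : I a -> supp c * supp a = supp a ->
    (forall b, supp a * b = b -> fst w b = c * b /\ snd w b = b * c) ->
    supp a * b = b -> fst v b = c^-1 * b /\ snd v b = b * c^-1.
  move=> Ia sc Hc Eb; rewrite /v /=.
  have [-> _] := Hc _ (supp_le (supp_idem a) Eb).
  rewrite ainv_mul ainv_supp; split.
    by rewrite (idem_central _ (supp_idem b)) amulA suppK.
  by rewrite -amulA mul_supp.
split; first exact: is_mult_of_local.
exists v; split.
  apply: is_mult_of_local => // a Ia; have [c [sc Hc]] := loc a Ia.
  exists c^-1; rewrite supp_ainv; split=> // b Eb.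
  exact: (vloc a).
move=> s Is; have [c [sc Hc]] := loc s Is.
have lv b := vloc s c b Is sc Hc.
have sK x : supp s * x = x -> supp c * x = x by move=> <-; rewrite -amulA sc.
have [v1 v2] := lv s (suppK s); have [w1 w2] := Hc s (suppK s).
rewrite v1 v2 w1 w2.
have M x : supp s * (x * s) = x * s by rewrite -amulA (idem_central x) // amulA suppK.
have M' x : supp s * (s * x) = s * x by rewrite -amulA suppK.
have [-> _] := Hc _ (M c^-1); have [-> _] := lv _ (M c).
have [_ ->] := Hc _ (M' c^-1); have [_ ->] := lv _ (M' c).
have cK : supp c * s = s by apply: sK; rewrite suppK.
rewrite !amulA mulVa mulaV -(idem_central s (supp_idem c)).
by rewrite conj_supp // conjV_supp // cK.
Qed.

End UnitMultipliers.

End Clifford.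

#[export] Hint Resolve supp_idem idemA_mul : car.

Section PartialInverse.

Context {A : Type} {amul : A -> A -> A} {I J : A -> Prop} {phi : A -> A}.
Hypothesis Hphi : part_iso amul I J phi.

Lemma pinv_spec b : J b -> I (pinv I phi b) /\ phi (pinv I phi b) = b.
Proof.
case: Hphi => _ [_ [H _]] /H ex.
exact: (epsilon_spec (inhabits b) (fun a => I a /\ phi a = b)).
Qed.

Lemma pinv_left a : I a -> pinv I phi (phi a) = a.
Proof.
case: (Hphi) => H [inj _] Ia; have [I' E] := pinv_spec (H a Ia).
exact: inj.
Qed.

End PartialInverse.

(** * From Sieben twisted modules to twisted partial actions *)

Existing Class sieben_module.

Section ModuleToAction.

Context {T : Type} {S : sgrp T} {HS : inverse_semigroup S} {HU : E_unitary S}.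
Context {A : Type} {amul : A -> A -> A} {HA : semilattice_of_groups amul}.
Context {L : tms T A} {HL : sieben_module S amul L}.

Local Notation car := (s_car S).
Local Notation idm := (idem S).
Local Notation "s · t" := (s_mul S s t) (at level 40, left associativity).
Local Notation inv := (sinv S).
Local Notation rng := (rng S).
Local Notation dom := (dom S).
Local Notation "a * b" := (amul a b).
Local Notation "a ^-1" := (ainv amul a) (at level 3, left associativity, format "a ^-1").
Local Notation supp := (supp amul).
Local Notation α := (alpha L).
Local Notation λ := (lam L).
Local Notation f := (fco L).
Local Notation G := (GS S).
Local Notation Θ := (ThetaL S amul L).

Implicit Types (s t u e : T) (a b : A) (x y z : T -> Prop).

Lemma alpha_idem e : idm e -> idemA amul (α e).
Proof. by case: HL => -[[H _] _] _; apply: H. Qed.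

Lemma alpha_inj e e' : idm e -> idm e' -> α e = α e' -> e = e'.
Proof. by case: HL => -[[_ [H _]] _] _; apply: H. Qed.

Lemma alpha_surj b : idemA amul b -> exists e, idm e /\ α e = b.
Proof. by case: HL => -[[_ [_ [H _]]] _] _; apply: H. Qed.

Lemma alpha_mul e e' : idm e -> idm e' -> α (e · e') = α e * α e'.
Proof. by case: HL => -[[_ [_ [_ H]]] _] _; apply: H. Qed.

Hint Resolve alpha_idem : car.

Lemma alpha_supp a : exists e, idm e /\ α e = supp a.
Proof. by apply: alpha_surj => //. Qed.

Lemma lam_endo s : car s -> endo amul (λ s).
Proof. by case: HL => -[_ [H _]] _ /H []. Qed.

Lemma lam_idem e a : idm e -> λ e a = α e * a.
Proof. by case: HL => -[_ [_ [_ [H _]]]] _; apply: H. Qed.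

Lemma fco_supp s t : car s -> car t -> supp (f s t) = α (rng (s · t)).
Proof.
case: HL => -[_ [_ [H _]]] _ cs ct; apply/HgrpE.
by move: (H s t cs ct); rewrite rng_mulE.
Qed.

Lemma lam_alpha s e : car s -> idm e -> λ s (α e) = α (rng (s · e)).
Proof.
by case: HL => -[_ [_ [_ [_ [H _]]]]] _ cs He; rewrite H // rng_mul_idem.
Qed.

Lemma lam_lam s t a : car s -> car t ->
  λ s (λ t a) = f s t * λ (s · t) a * (f s t)^-1.
Proof. by case: HL => -[_ [_ [_ [_ [_ [H _]]]]]] _; apply: H. Qed.

Lemma fco_cocycle s t u : car s -> car t -> car u ->
  λ s (f t u) * f s (t · u) = f s t * f (s · t) u.
Proof. by case: HL => -[_ [_ [_ [_ [_ [_ [_ H]]]]]]] _; apply: H. Qed.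

Lemma fco_idemr s e : car s -> idm e -> f s e = α (rng (s · e)).
Proof. by case: HL => _ H cs He; rewrite rng_mul_idem //; case: (H s e). Qed.

Lemma fco_ideml e s : car s -> idm e -> f e s = α (rng (e · s)).
Proof.
by case: HL => _ H cs He; rewrite rng_idem_mulE //; case: (H s e).
Qed.

Lemma alpha_le e e' a : idm e -> idm e' -> e · e' = e' -> α e' * a = a -> α e * a = a.
Proof. by move=> He He' E <-; rewrite -amulA -alpha_mul // E. Qed.

Lemma lam_supp s e a : car s -> idm e -> α e * a = a ->
  α (rng (s · e)) * λ s a = λ s a.
Proof. by move=> cs He E; rewrite -lam_alpha // -lam_endo // E. Qed.

Lemma supp_lam s e a : car s -> idm e -> α e = supp a -> supp (λ s a) = α (rng (s · e)).
Proof. by move=> cs He E; rewrite (endo_supp (lam_endo cs)) -E lam_alpha. Qed.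

Lemma lam_rng s a : car s -> α (rng s) * λ s a = λ s a.
Proof.
move=> cs; have [e [He E]] := alpha_supp a.
apply: (@alpha_le _ (rng (s · e))) => //; first exact: rng_mul_le.
by apply: lam_supp => //; rewrite E suppK.
Qed.

Lemma lam_dom s a : car s -> λ s (α (dom s) * a) = λ s a.
Proof. by move=> cs; rewrite lam_endo // lam_alpha // rng_mul_dom // lam_rng. Qed.

(** Composition with λ_e, which multiplies by α(e); the twist f(s, e) is an idempotent, so the
    conjugation in the composition law is harmless. *)
Lemma lam_mul_idem s e a : car s -> idm e -> λ (s · e) a = λ s (α e * a).
Proof.
move=> cs He; rewrite -lam_idem // lam_lam // fco_idemr // ainv_idem //.
by rewrite -idem_central // -amulA idemM // lam_rng.
Qed.

Lemma lam_idem_mul s e a : car s -> idm e -> λ (e · s) a = α e * λ s a.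
Proof.
move=> cs He; rewrite -lam_idem // lam_lam // fco_ideml // ainv_idem //.
by rewrite -idem_central // -amulA idemM // lam_rng.
Qed.

Lemma fco_rng s t : car s -> car t -> α (rng (s · t)) * f s t = f s t.
Proof. by move=> cs ct; rewrite -fco_supp // suppK. Qed.

Lemma fco_rngl s t : car s -> car t -> α (rng s) * f s t = f s t.
Proof.
move=> cs ct; apply: (@alpha_le _ (rng (s · t))) => //; first exact: rng_mul_le.
exact: fco_rng.
Qed.

(** The cocycle identity at (e, s, t), where the Sieben condition trivializes both values of f with
    first argument e. *)
Lemma fco_idem_mull s t e : car s -> car t -> idm e -> f (e · s) t = α e * f s t.
Proof.
move=> cs ct He; have := fco_cocycle (idem_car He) cs ct.
rewrite lam_idem // !(fco_ideml _ He) // (fco_rngl (s := e · s)) // => <-.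
rewrite rng_idem_mul // alpha_mul // -(fco_supp cs ct) -{2}(supp_of_idem (alpha_idem He)).
by rewrite -supp_mul mul_supp.
Qed.

(** The cocycle identity at (s, e, u), where the Sieben condition trivializes f(e, u) and f(s,
    e). *)
Lemma fco_mid s e u : car s -> car u -> idm e -> f s (e · u) = f (s · e) u.
Proof.
move=> cs cu He; have := fco_cocycle cs (idem_car He) cu.
rewrite (fco_ideml cu He) (fco_idemr cs He) lam_alpha // rng_mul_rng //.
by rewrite fco_rng // fco_rngl.
Qed.

Lemma fco_mid_rng s t u : car s -> car t -> car u ->
  f s (rng t · u) = α (rng (s · t)) * f s u.
Proof.
move=> cs ct cu.
by rewrite fco_mid // mul_idem_slide // rng_mul_rng // fco_idem_mull.
Qed.

Lemma lam_lam_inv s a : car s ->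
  λ (inv s) (λ s a) = f (inv s) s * (α (dom s) * a) * (f (inv s) s)^-1.
Proof. by move=> cs; rewrite lam_lam // -domE lam_idem. Qed.

(** λ_{s^{-1}} undoes λ_s up to conjugation by f(s^{-1}, s), which is invertible over α(s^{-1}s). *)
Lemma lam_inj s a b : car s -> α (dom s) * a = a -> α (dom s) * b = b ->
  λ s a = λ s b -> a = b.
Proof.
move=> cs Ea Eb E; move: (lam_lam_inv a cs); rewrite E lam_lam_inv // Ea Eb.
set c := f _ _; have sc : supp c = α (dom s) by rewrite /c fco_supp // -domE rng_of_idem.
move=> /(f_equal (fun d => c^-1 * (d * c))).
by rewrite !amulA !mulVa sc -!(idem_central _ (alpha_idem _)) // Ea Eb !conjV_supp ?sc.
Qed.

Lemma lam_surj s b : car s -> α (rng s) * b = b ->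
  exists a, α (dom s) * a = a /\ λ s a = b.
Proof.
move=> cs Eb; set c := f s (inv s).
have sc : supp c = α (rng s) by rewrite /c fco_supp // -rngE rng_of_idem.
(* λ_s λ_{s^{-1}} is conjugation by [c] over α(ss^{-1}), so [b] is conjugated back beforehand. *)
exists (λ (inv s) (c^-1 * b * c)); split; first by rewrite -rng_inv // lam_rng.
rewrite lam_lam // -/c -rngE lam_idem // -sc; rewrite -sc in Eb.
have -> : supp c * (c^-1 * b * c) = c^-1 * b * c by rewrite -!amulA -supp_ainv suppK.
by rewrite !amulA mulaV -(idem_central b (supp_idem c)) Eb conj_supp.
Qed.

Lemma lam_sigma s t a : sigma S s t -> α (dom s) * a = a -> α (dom t) * a = a ->
  λ s a = λ t a.
Proof.
move=> st Es Et; have [cs [ct _]] := st.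
by rewrite -{1}Et -lam_mul_idem // (sigma_dom st) lam_mul_idem // Es.
Qed.

(** Let α(e) be the support of a. Then e lies below the ranges of s and s', so es = es', and f
    respects multiplication of its first argument by e. For the second argument, [fco_mid_rng] cuts
    u by the range of u' and conversely, and by [sigma_rng] these cuts coincide. *)
Lemma fco_sigma s s' u u' a : sigma S s s' -> sigma S u u' ->
  α (rng (s · u)) * a = a -> α (rng (s' · u')) * a = a -> f s u * a = f s' u' * a.
Proof.
move=> ss uu E E'; have [cs [cs' _]] := ss; have [cu [cu' _]] := uu.
have [e [He Ee]] := alpha_supp a.
have le s0 u0 : car s0 -> car u0 -> α (rng (s0 · u0)) * a = a -> e · rng (s0 · u0) = e.
  move=> c0 c1 E0; apply: alpha_inj => //; rewrite alpha_mul // -idem_central // Ee.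
  exact: supp_le.
have le1 := le _ _ cs cu E; have le2 := le _ _ cs' cu' E'.
have es : e · s = e · s'.
  apply: sigma_idem_eq => //.
    by rewrite -{1}le1 mulA // (idem_comm (rng_idem (mul_car cs cu))) // rng_mul_le.
  by rewrite -{1}le2 mulA // (idem_comm (rng_idem (mul_car cs' cu'))) // rng_mul_le.
have red s0 u0 : car s0 -> car u0 -> f s0 u0 * a = f (e · s0) u0 * a.
  by move=> c0 c1; rewrite fco_idem_mull // Ee (idem_central _ (supp_idem a)) amulA suppK.
rewrite (red s u) // (red s' u') // -es.
have le3 u0 : car u0 -> α (rng (s · u0)) * a = a -> α (rng (e · s · u0)) * a = a.
  by move=> c0 E0; rewrite mulA // rng_idem_mul // alpha_mul // amulA E0 Ee suppK.
have E3 := le3 _ cu E.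
have {E'} E4 : α (rng (e · s · u')) * a = a.
  by rewrite es mulA // rng_idem_mul // alpha_mul // amulA E' Ee suppK.
rewrite -{1}E4 -{2}E3 -!amulA -!(idem_central _ (alpha_idem _)) // -!fco_mid_rng //.
by rewrite (sigma_rng uu).
Qed.

(** * Domains, maps and multipliers of Θ^Λ through arbitrary representatives *)

Lemma ThetaL_D x a : g_car G x ->
  D Θ x a <-> exists s, x s /\ α (rng s) * a = a.
Proof.
move=> gx; split=> /= [[s [xs /HgrpE E]]|[s [xs E]]].
  by exists s; split=> //; rewrite rngE -E suppK.
have cs := car_of_mem gx xs; have [e [He Ee]] := alpha_supp a.
(* Cutting [s] by [e] stays in the class and lowers its range to exactly the support of [a]. *)
exists (e · s); split; first exact: class_idem_mul.
apply/HgrpE; rewrite -rngE rng_idem_mul // alpha_mul // Ee.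
by rewrite -idem_central // supp_le.
Qed.

Lemma ThetaL_D_exact x a : D Θ x a -> exists s, x s /\ α (rng s) = supp a.
Proof. by case=> s [xs /HgrpE E]; exists s; rewrite rngE. Qed.

Lemma ThetaL_Dinv_exact x a : g_car G x -> D Θ (g_inv G x) a ->
  exists s, x s /\ α (dom s) = supp a.
Proof.
move=> gx /ThetaL_D_exact [s [xs E]]; exists (inv s).
have gx' : g_car G (g_inv G x) by exact: GS_inv_car.
have cs := car_of_mem gx' xs.
split; last by rewrite dom_inv.
have [t xt] := class_inhabited gx; have ct := car_of_mem gx xt.
rewrite -(inv_inv ct) in xt; apply: (class_sigma_mem gx xt).
apply: sigma_inv; apply: (class_sigma gx') => //.
by apply: GS_inv_mem => //; rewrite -(inv_inv ct).
Qed.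

Lemma ThetaL_Dinv x a : g_car G x ->
  D Θ (g_inv G x) a <-> exists s, x s /\ α (dom s) * a = a.
Proof.
move=> gx; split.
  by move=> /(ThetaL_Dinv_exact gx) [s [xs E]]; exists s; rewrite E suppK.
case=> s [xs E]; apply/ThetaL_D; first exact: GS_inv_car.
exists (inv s); split; first exact: GS_inv_mem.
by rewrite rng_inv //; apply: car_of_mem xs.
Qed.

(* The construction uses the unique [s] in [x] whose domain is the support of
   [a]; by E-unitarity any [s] in [x] whose domain lies above it will do. *)
Lemma ThetaL_theta x s a : g_car G x -> x s -> α (dom s) * a = a ->
  theta Θ x a = λ s a.
Proof.
move=> gx xs E /=; set P := fun b => _.
have [t [xt [Et ->]]] : P (epsilon (inhabits a) P).
  apply: epsilon_spec; have [e [He Ee]] := alpha_supp a.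
  have cs := car_of_mem gx xs.
  exists (λ (s · e) a), (s · e); split; first exact: class_mul_idem.
  split=> //; rewrite -domE dom_mul_idem // alpha_mul // mulaV Ee.
  by rewrite -idem_central // supp_le.
apply: lam_sigma => //; first exact: (class_sigma gx).
by rewrite domE Et mulaV suppK.
Qed.

(** Shows that the choice in the definition of w_{x,y} has a candidate; [ThetaL_w_choice] shows that
    all candidates have the same effect on [a]. *)
Lemma ThetaL_w_witness x y s u a : g_car G x -> g_car G y -> x s -> y u ->
  α (rng (s · u)) * a = a ->
  exists s' t, x s' /\ g_mul G x y t /\
    α (s' · inv s') = a * a^-1 /\ α (t · inv t) = a * a^-1.
Proof.
move=> gx gy xs yu E; have [e [He Ee]] := alpha_supp a.
have cs := car_of_mem gx xs; have cu := car_of_mem gy yu.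
have Es : α (rng s) * a = a.
  by apply: (@alpha_le _ (rng (s · u))) => //; apply: rng_mul_le.
exists (e · s), (e · (s · u)); split; first exact: class_idem_mul.
split; first by apply: class_idem_mul; [apply: GS_mul_car | apply: GS_mul_mem |].
rewrite -!rngE !(rng_idem_mul He) // !alpha_mul // Ee mulaV.
by rewrite -!(idem_central (supp a) (alpha_idem _)) // !supp_le.
Qed.

Lemma ThetaL_w_choice x y s u s' t a : g_car G x -> g_car G y -> x s -> y u ->
  α (rng (s · u)) * a = a -> x s' -> g_mul G x y t ->
  α (s' · inv s') = a * a^-1 -> α (t · inv t) = a * a^-1 ->
  f s' (inv s' · t) * a = f s u * a.
Proof.
move=> gx gy xs yu E xs' xyt; rewrite -!rngE mulaV => Es' Et.
have cs' := car_of_mem gx xs'; have ct := car_of_mem (GS_mul_car gx gy) xyt.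
apply: fco_sigma => //; first exact: (class_sigma gx).
  by apply: (class_sigma gy) => //; apply: class_divl xyt.
rewrite -mulA // -rngE rng_idem_mul // alpha_mul // Es' Et.
by rewrite amulA !suppK.
Qed.

Lemma ThetaL_wl x y s u a : g_car G x -> g_car G y -> x s -> y u ->
  α (rng (s · u)) * a = a -> fst (w Θ x y) a = f s u * a.
Proof.
move=> gx gy xs yu E /=; set P := fun b => _.
have [s' [t [xs' [xyt [Es' [Et ->]]]]]] : P (epsilon (inhabits a) P).
  apply: epsilon_spec; have [s' [t [h1 [h2 [h3 h4]]]]] := ThetaL_w_witness gx gy xs yu E.
  by exists (f s' (inv s' · t) * a), s', t; split=> //; split=> //; split.
exact: (@ThetaL_w_choice x y).
Qed.

Lemma ThetaL_wr x y s u a : g_car G x -> g_car G y -> x s -> y u ->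
  α (rng (s · u)) * a = a -> snd (w Θ x y) a = a * f s u.
Proof.
move=> gx gy xs yu E /=; set P := fun b => _.
have [s' [t [xs' [xyt [Es' [Et ->]]]]]] : P (epsilon (inhabits a) P).
  apply: epsilon_spec; have [s' [t [h1 [h2 [h3 h4]]]]] := ThetaL_w_witness gx gy xs yu E.
  by exists (a * f s' (inv s' · t)), s', t; split=> //; split=> //; split.
have cs := car_of_mem gx xs; have cu := car_of_mem gy yu.
(* The independence statement concerns translation from the left; applied to the central idempotent
   [supp a] it also serves on the right. *)
rewrite -(mul_supp a) !amulA !(idem_central _ (supp_idem a)); congr (a * _).
apply: (@ThetaL_w_choice x y) => //; first exact: supp_le.
  by rewrite mulaV supp_supp -mulaV.
by rewrite mulaV supp_supp -mulaV.
Qed.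

Lemma ThetaL_acts x y s u e : g_car G x -> g_car G y -> x s -> y u -> idm e ->
  e · rng (s · u) = e -> acts amul (w Θ x y) (α e) (f s u).
Proof.
move=> gx gy xs yu He E; have cs := car_of_mem gx xs; have cu := car_of_mem gy yu.
split; first by rewrite fco_supp // -alpha_mul // (idem_comm _ He) // E.
move=> b Eb; have Eb' : α (rng (s · u)) * b = b.
  by apply: (@alpha_le _ e) => //; rewrite (idem_comm _ He) // E.
by rewrite (ThetaL_wl gx gy xs yu) // (ThetaL_wr gx gy xs yu).
Qed.

#[local] Instance GS_group_instance : group G.
Proof. exact: GS_group. Qed.

Hint Resolve GS_group_instance : car.

Lemma ThetaL_ideal x : g_car G x -> ideal amul (D Θ x).
Proof.
move=> gx; split.
  have [s xs] := class_inhabited gx; have cs := car_of_mem gx xs.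
  by exists (α (rng s)); apply/(ThetaL_D _ gx); exists s; rewrite idemM //; apply: alpha_idem => //.
move=> a b /(ThetaL_D _ gx) [s [xs E]]; have cs := car_of_mem gx xs.
split; apply/(ThetaL_D _ gx); exists s; split=> //; last by rewrite -amulA E.
by rewrite -amulA (idem_central a) // amulA E.
Qed.

(** For s in x and t in xy with range matching a, the element u = s^{-1}t is exactly composable with
    s, so su has the range of s and f(s, u) is invertible over the full support of a. *)
Lemma ThetaL_pair x y a : g_car G x -> g_car G y -> D Θ x a -> D Θ (g_mul G x y) a ->
  exists s u, x s /\ y u /\ rng u = dom s /\ α (rng s) = supp a.
Proof.
move=> gx gy /ThetaL_D_exact [s [xs Es]] /ThetaL_D_exact [t [xyt Et]].
have cs := car_of_mem gx xs; have ct := car_of_mem (GS_mul_car gx gy) xyt.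
exists s, (inv s · t); split=> //; split; first exact: class_divl xyt.
split=> //; rewrite -rng_mul_rng // -(@alpha_inj (rng s) (rng t)) ?Es ?Et //.
by rewrite -(dom_inv cs) mul_dom_self // rng_inv.
Qed.

Lemma ThetaL_setprod x y a : g_car G x -> g_car G y ->
  setprod amul (D Θ x) (D Θ y) a <-> D Θ x a /\ D Θ y a.
Proof. by move=> gx gy; apply: setprodE; apply: ThetaL_ideal. Qed.

Lemma rng_mul_eq s u : car s -> car u -> rng u = dom s -> rng (s · u) = rng s.
Proof. by move=> cs cu E; rewrite -rng_mul_rng // E rng_mul_dom. Qed.

Lemma ThetaL_part_iso x : g_car G x ->
  part_iso amul (D Θ (g_inv G x)) (D Θ x) (theta Θ x).
Proof.
move=> gx; split; [|split; [|split]].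
- move=> a /(ThetaL_Dinv _ gx) [s [xs E]]; have cs := car_of_mem gx xs.
  rewrite (ThetaL_theta gx xs E); apply/(ThetaL_D _ gx); exists s.
  by split=> //; apply: lam_rng.
- move=> a b /(ThetaL_Dinv_exact gx) [s [xs Es]] /(ThetaL_Dinv_exact gx) [t [xt Et]].
  have cs := car_of_mem gx xs; have ct := car_of_mem gx xt.
  have Ea : α (dom s) * a = a by rewrite Es suppK.
  have Eb : α (dom t) * b = b by rewrite Et suppK.
  rewrite (ThetaL_theta gx xs Ea) (ThetaL_theta gx xt Eb) => E.
  (* The range of each representative is read off from the support of the common image. *)
  have st : s = t.
    apply: sigma_eq_rng; first exact: (class_sigma gx).
    apply: alpha_inj => //; move: (f_equal supp E).
    by rewrite (supp_lam cs _ Es) // (supp_lam ct _ Et) // !rng_mul_dom.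
  by rewrite -st in Eb E; apply: (lam_inj cs).
- move=> b /(ThetaL_D _ gx) [s [xs E]]; have cs := car_of_mem gx xs.
  have [a [Ea Eab]] := lam_surj cs E.
  exists a; split; first by apply/(ThetaL_Dinv _ gx); exists s.
  by rewrite (ThetaL_theta gx xs Ea).
- move=> a b /(ThetaL_Dinv _ gx) [s [xs Es]] /(ThetaL_Dinv _ gx) [t [xt Et]].
  have cs := car_of_mem gx xs; have ct := car_of_mem gx xt.
  have st : sigma S s t by exact: (class_sigma gx).
  have Est : α (dom s) * (a * b) = a * b by rewrite -amulA Es.
  rewrite (ThetaL_theta gx xs Est) (ThetaL_theta gx xs Es) (ThetaL_theta gx xt Et).
  (* The two factors have different representatives. The restriction [s · dom t] serves both: it
     equals [rng t · s] and [rng s · t], and the surplus idempotents are absorbed by the product. *)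
  have -> : λ s (a * b) = λ (s · dom t) (a * b).
    rewrite lam_mul_idem // -amulA (idem_central a) // amulA.
    by rewrite Et.
  rewrite (lam_endo (s := s · dom t)) // {1}(sigma_dom_rng st).
  rewrite (sigma_dom st) (sigma_dom_rng (sigma_sym st)) !lam_idem_mul //.
  rewrite (idem_central (λ s a)) // amulA -(amulA (α (rng t))).
  rewrite (idem_central (α (rng s))) // amulA lam_rng // -amulA.
  by rewrite -(idem_central (λ s a)) // lam_rng.
Qed.

Lemma ThetaL_acts_exact x y s u : g_car G x -> g_car G y -> x s -> y u ->
  rng u = dom s -> acts amul (w Θ x y) (α (rng s)) (f s u).
Proof.
move=> gx gy xs yu E; have cs := car_of_mem gx xs; have cu := car_of_mem gy yu.
by apply: ThetaL_acts => //; rewrite rng_mul_eq // idem_mul.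
Qed.

Lemma ThetaL_unit_mult x y : g_car G x -> g_car G y ->
  is_unit_mult amul (setprod amul (D Θ x) (D Θ (g_mul G x y))) (w Θ x y).
Proof.
move=> gx gy; pose proof (GS_mul_car gx gy) as gxy; apply: is_unit_multP.
  by apply: ideal_setprod; apply: ThetaL_ideal.
move=> b /(ThetaL_setprod _ gx gxy) [Dx Dxy] Hb.
have [s [u [xs [yu [E Es]]]]] := ThetaL_pair gx gy Dx Dxy.
exists (f s u); rewrite -(supp_of_idem Hb) -Es.
exact: ThetaL_acts_exact.
Qed.

Lemma ThetaL_image x y : g_car G x -> g_car G y ->
  seteq (image (theta Θ x) (setprod amul (D Θ (g_inv G x)) (D Θ y)))
        (setprod amul (D Θ x) (D Θ (g_mul G x y))).
Proof.
move=> gx gy b; pose proof (GS_mul_car gx gy) as gxy; pose proof (GS_inv_car gx) as gx'.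
split.
  case=> a [/(ThetaL_setprod _ gx' gy) [/(ThetaL_Dinv _ gx) [s [xs Es]]]].
  move=> /(ThetaL_D _ gy) [u [yu Eu]] ->.
  have cs := car_of_mem gx xs; have cu := car_of_mem gy yu.
  rewrite (ThetaL_theta gx xs Es); apply/(ThetaL_setprod _ gx gxy); split.
    by apply/(ThetaL_D _ gx); exists s; split=> //; apply: lam_rng.
  apply/(ThetaL_D _ gxy); exists (s · u); split; first exact: GS_mul_mem.
  by rewrite -rng_mul_rng //; apply: lam_supp.
move=> /(ThetaL_setprod _ gx gxy) [Dx Dxy].
have [s [u [xs [yu [E Es]]]]] := ThetaL_pair gx gy Dx Dxy.
have cs := car_of_mem gx xs.
have [a [Ea Eb]] : exists a, α (dom s) * a = a /\ λ s a = b.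
  by apply: lam_surj => //; rewrite Es suppK.
exists a; split; last by rewrite (ThetaL_theta gx xs Ea).
apply/(ThetaL_setprod _ gx' gy); split.
  by apply/(ThetaL_Dinv _ gx); exists s.
by apply/(ThetaL_D _ gy); exists u; rewrite E.
Qed.

Lemma ThetaL_compose x y b : g_car G x -> g_car G y ->
  setprod amul (D Θ (g_inv G y)) (D Θ (g_mul G (g_inv G y) (g_inv G x))) b ->
  theta Θ x (theta Θ y b) =
  snd (minv amul (setprod amul (D Θ x) (D Θ (g_mul G x y))) (w Θ x y))
      (fst (w Θ x y) (theta Θ (g_mul G x y) b)).
Proof.
move=> gx gy; pose proof (GS_mul_car gx gy) as gxy.
pose proof (GS_inv_car gy) as gy'; pose proof (GS_inv_car gxy) as gxy'.
rewrite -ginv_mul // => /(ThetaL_setprod _ gy' gxy') [].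
move=> /(ThetaL_Dinv_exact gy) [t [yt Et]] /(ThetaL_Dinv_exact gxy) [p [xyp Ep]].
have ct := car_of_mem gy yt; have cp := car_of_mem gxy xyp.
have dd : dom t = dom p by apply: alpha_inj => //; rewrite Et Ep.
(* As [t] and [p] have the same domain, u = pt^{-1} satisfies ut = p exactly, and the composition
   law of λ at (u, t) is the required identity. *)
have xu : x (p · inv t) by apply: (class_divr gx gy).
have Eu : p · inv t · t = p by rewrite mulA // -domE dd mul_dom_self.
have Du : dom (p · inv t) = rng t.
  by rewrite dom_mul // inv_inv // -dd mul_dom_self // rngE.
have Ru : rng (p · inv t) · rng p = rng p by rewrite -{2 3}Eu rng_mul_le.
have Et' : α (dom t) * b = b by rewrite Et suppK.
have Ep' : α (dom p) * b = b by rewrite Ep suppK.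
rewrite (ThetaL_theta gy yt Et') (ThetaL_theta gxy xyp Ep').
rewrite (ThetaL_theta gx xu); first by rewrite Du lam_rng.
rewrite lam_lam // Eu; set c := f _ t.
have Ha : acts amul (w Θ x y) (α (rng p)) c.
  by apply: ThetaL_acts => //; rewrite Eu idem_mul.
have Hl := lam_rng b cp.
rewrite (actsL Ha Hl).
set I := setprod amul _ _.
have HI : ideal amul I by apply: ideal_setprod; apply: ThetaL_ideal.
have Ip : I (α (rng p)).
  apply/(ThetaL_setprod _ gx gxy); split.
    apply/(ThetaL_D _ gx); exists (p · inv t); split=> //.
    by rewrite -alpha_mul // Ru.
  by apply/(ThetaL_D _ gxy); exists p; rewrite idemM //; apply: alpha_idem => //.
have Ha' : acts amul (minv amul I (w Θ x y)) (α (rng p)) c^-1.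
  by apply: minv_acts => //; apply: ThetaL_unit_mult.
rewrite (actsR Ha') //.
by rewrite -amulA (idem_central c) // amulA Hl.
Qed.

Lemma ThetaL_w_one x : g_car G x ->
  is_id_mult (D Θ x) (w Θ (g_one G) x) /\ is_id_mult (D Θ x) (w Θ x (g_one G)).
Proof.
move=> gx; have g1 : g_car G (g_one G) by apply: GS_one_car.
split=> a /(ThetaL_D _ gx) [s [xs E]]; have cs := car_of_mem gx xs.
  have i1 : g_one G (rng s) by apply: GS_one_mem => //.
  have E' : α (rng (rng s · s)) * a = a by rewrite rng_mul_self.
  rewrite (ThetaL_wl g1 gx i1 xs E') (ThetaL_wr g1 gx i1 xs E') fco_ideml //.
  by split; rewrite // -(idem_central a) // E'.
have i1 : g_one G (dom s) by apply: GS_one_mem => //.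
have E' : α (rng (s · dom s)) * a = a by rewrite mul_dom_self.
rewrite (ThetaL_wl gx g1 xs i1 E') (ThetaL_wr gx g1 xs i1 E') fco_idemr //.
by split; rewrite // -(idem_central a) // E'.
Qed.

(** With representatives chosen so that the domain of s is the range of t and the domain of t is the
    range of u, all products starting with s have the range of s. Then no cutting down occurs and
    the module cocycle applies directly. *)
Lemma ThetaL_cocycle x y z a : g_car G x -> g_car G y -> g_car G z ->
  setprod amul (setprod amul (D Θ (g_inv G x)) (D Θ y)) (D Θ (g_mul G y z)) a ->
  snd (w Θ x (g_mul G y z)) (theta Θ x (snd (w Θ y z) a)) =
  snd (w Θ (g_mul G x y) z) (snd (w Θ x y) (theta Θ x a)).
Proof.
move=> gx gy gz; pose proof (GS_mul_car gy gz) as gyz; pose proof (GS_mul_car gx gy) as gxy.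
pose proof (GS_inv_car gx) as gx'.
case/setprodE; [by apply: ideal_setprod; apply: ThetaL_ideal | exact: ThetaL_ideal |].
move=> /(ThetaL_setprod _ gx' gy) [/(ThetaL_Dinv_exact gx) [s [xs Es]] Dy] Dyz.
have [t [u [yt [zu [Eu Et]]]]] := ThetaL_pair gy gz Dy Dyz.
have cs := car_of_mem gx xs; have ct := car_of_mem gy yt; have cu := car_of_mem gz zu.
have Est : rng t = dom s by apply: alpha_inj => //; rewrite Es Et.
have Rtu : rng (t · u) = rng t by rewrite rng_mul_eq.
have Rst : rng (s · t) = rng s by rewrite rng_mul_eq.
have Rstu : rng (s · (t · u)) = rng s by rewrite rng_mul_eq // Rtu.
have Ea : α (dom s) * a = a by rewrite Es suppK.
have Ea' : α (rng (t · u)) * a = a by rewrite Rtu Et suppK.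
rewrite (ThetaL_wr gy gz yt zu Ea') (ThetaL_theta gx xs Ea).
have Ef : α (dom s) * (a * f t u) = a * f t u by rewrite -amulA Ea.
rewrite (ThetaL_theta gx xs Ef).
rewrite (ThetaL_wr gx gyz xs (GS_mul_mem gy gz yt zu)); first by rewrite Rstu lam_rng.
have E1 : α (rng (s · t)) * λ s a = λ s a by rewrite Rst lam_rng.
rewrite (ThetaL_wr gx gy xs yt E1).
rewrite (ThetaL_wr gxy gz (GS_mul_mem gx gy xs yt) zu);
  first by rewrite mulA // Rstu -amulA lam_rng.
by rewrite lam_endo // !amulA fco_cocycle.
Qed.

Lemma ThetaL_twisted_partial_action : twisted_partial_action G amul Θ.
Proof.
have g1 : g_car G (g_one G) by apply: GS_one_car.
split; first exact: ThetaL_ideal.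
split; first exact: ThetaL_part_iso.
split; first exact: ThetaL_unit_mult.
split.
  by move=> x gx a; split; [move=> /(ThetaL_setprod _ gx gx) [] | move=> H; apply/(ThetaL_setprod _ gx gx)].
split.
  move=> x y gx gy a; split; move=> /ThetaL_setprod [] // h1 h2;
    by apply/ThetaL_setprod.
split.
  move=> a; have [e [He Ee]] := alpha_supp a; apply/(ThetaL_D _ g1); exists e.
  by split; [apply: GS_one_mem | rewrite rng_of_idem // Ee suppK].
split.
  move=> a; have [e [He Ee]] := alpha_supp a.
  have E : α e * a = a by rewrite Ee suppK.
  by rewrite (ThetaL_theta g1 (GS_one_mem He)) ?lam_idem // dom_of_idem.
split; first exact: ThetaL_image.
split; first by move=> x y b; apply: ThetaL_compose.
split; first exact: ThetaL_w_one.
exact: ThetaL_cocycle.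
Qed.

(** The isomorphism ν of the theorem. It is injective because range and σ-class determine an element
    of an E-unitary semigroup. *)
Definition module_iso s : A * (T -> Prop) := (α (rng s), sigma S s).

Lemma ThetaL_theta_inv s : car s -> theta_inv G Θ (sigma S s) (α (rng s)) = α (dom s).
Proof.
move=> cs; pose proof (GS_car_class cs) as gx.
pose proof (sigma_refl cs) as ss.
have E : α (dom s) * α (dom s) = α (dom s) by rewrite idemM.
have <- : theta Θ (sigma S s) (α (dom s)) = α (rng s).
  by rewrite (ThetaL_theta gx ss E) lam_alpha // rng_mul_dom.
apply: (pinv_left (ThetaL_part_iso gx)).
by apply/(ThetaL_Dinv _ gx); exists s.
Qed.

Lemma ThetaL_lam s a : car s ->
  theta Θ (sigma S s) (theta_inv G Θ (sigma S s) (α (rng s)) * a) = λ s a.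
Proof.
move=> cs; pose proof (GS_car_class cs) as gx; pose proof (sigma_refl cs) as ss.
by rewrite ThetaL_theta_inv // (ThetaL_theta gx ss) ?lam_dom // idemK.
Qed.

Lemma lam_alpha_rng s t : car s -> car t -> λ s (α (rng t)) = α (rng (s · t)).
Proof. by move=> cs ct; rewrite lam_alpha // rng_mul_rng. Qed.

Lemma module_iso_sgrp_iso : sgrp_iso S (EStar G amul Θ) module_iso.
Proof.
split; [|split; [|split]].
- move=> s cs; pose proof (GS_car_class cs) as gx; split=> //=.
  split; first by apply: alpha_idem => //.
  apply/(ThetaL_D _ gx); exists s; split; first exact: sigma_refl.
  by rewrite idemM //; apply: alpha_idem => //.
- move=> s t cs ct [E1 E2]; apply: sigma_eq_rng; last exact: alpha_inj.
  by rewrite E2; apply: sigma_refl.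
- case=> b x [/= gx [ib /ThetaL_D_exact [s [xs Es]]]].
  have cs := car_of_mem gx xs; exists s; split=> //.
  by rewrite /module_iso Es supp_of_idem // (class_of_mem gx xs).
- move=> s t cs ct; cbn [EStar s_mul module_iso fst snd]; rewrite ThetaL_lam // GS_mulE //.
  by rewrite lam_alpha_rng.
Qed.

Lemma module_iso_tms_eq : tms_eq S L (tms_comp (LambdaT G amul Θ) module_iso).
Proof.
split; first by move=> e He /=; rewrite rng_of_idem.
split; first by move=> s a cs; cbn [tms_comp LambdaT lam module_iso fst snd]; rewrite ThetaL_lam.
move=> s t cs ct; cbn [tms_comp LambdaT fco module_iso fst snd].
pose proof (GS_car_class cs) as gx; pose proof (GS_car_class ct) as gy.
rewrite ThetaL_lam // lam_alpha_rng //.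
rewrite (ThetaL_wr gx gy (sigma_refl cs) (sigma_refl ct)) ?fco_rng //.
by rewrite idemM //; apply: alpha_idem => //.
Qed.

End ModuleToAction.

#[export] Hint Extern 1 (idemA _ (alpha _ _)) => apply: alpha_idem : car.

(** * From equivalent modules to equivalent actions *)

Section ModuleEquivalence.

Context {T : Type} {S : sgrp T} {HS : inverse_semigroup S} {HU : E_unitary S}.
Context {A : Type} {amul : A -> A -> A} {HA : semilattice_of_groups amul}.
Context {L L' : tms T A} {HL : sieben_module S amul L} {HL' : sieben_module S amul L'}.

Local Notation car := (s_car S).
Local Notation idm := (idem S).
Local Notation "s · t" := (s_mul S s t) (at level 40, left associativity).
Local Notation inv := (sinv S).
Local Notation rng := (rng S).
Local Notation dom := (dom S).
Local Notation "a * b" := (amul a b).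
Local Notation "a ^-1" := (ainv amul a) (at level 3, left associativity, format "a ^-1").
Local Notation supp := (supp amul).
Local Notation α := (alpha L).
Local Notation λ := (lam L).
Local Notation f := (fco L).
Local Notation α' := (alpha L').
Local Notation λ' := (lam L').
Local Notation f' := (fco L').
Local Notation G := (GS S).
Local Notation Θ := (ThetaL S amul L).
Local Notation Θ' := (ThetaL S amul L').

Hypothesis Eα : forall e, idm e -> α' e = α e.
Context (g : T -> A).
Hypothesis Hg : forall s, car s -> supp (g s) = α (rng s).
Hypothesis Hλ : forall s a, car s -> λ' s a = g s * λ s a * (g s)^-1.
Hypothesis Hf : forall s t, car s -> car t ->
  f' s t * g (s · t) = g s * λ s (g t) * f s t.

(** At (e, e) both twists equal α(e), so the coboundary condition says that g(e) is idempotent in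
    the group over α(e). *)
Lemma cobound_idem e : idm e -> g e = α e.
Proof.
move=> He; have ce := idem_car He; have := Hf ce ce.
have sg : supp (g e) = α e by rewrite Hg // rng_of_idem.
rewrite !(fco_idemr _ He) // (idem_mul He) rng_of_idem // Eα // lam_idem // -sg.
rewrite suppK amulA mul_supp => E.
by rewrite (idem_group_elt (eq_sym E)).
Qed.

(** The coboundary condition at (e, s). It makes g compatible with the natural order, so the values
    g(s) for s in one σ-class glue to a multiplier. *)
Lemma cobound_idem_mul e s : idm e -> car s -> g (e · s) = α e * g s.
Proof.
move=> He cs; have := Hf (idem_car He) cs.
rewrite !(fco_ideml _ He) // (cobound_idem He) lam_idem // idemK; first by apply: alpha_idem.
rewrite Eα // -(Hg (s := e · s)) // suppK => ->.
rewrite (Hg (s := e · s)) // rng_idem_mul // alpha_mul // -(Hg cs).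
by rewrite -{2}(supp_of_idem (alpha_idem He)) -supp_mul mul_supp.
Qed.

Definition cobound_mult (x : T -> Prop) : mult A :=
  (fun a => epsilon (inhabits a)
     (fun b => exists s, x s /\ α (rng s) = supp a /\ b = g s * a),
   fun a => epsilon (inhabits a)
     (fun b => exists s, x s /\ α (rng s) = supp a /\ b = a * g s)).

Lemma cobound_mult_acts x s : g_car G x -> x s ->
  acts amul (cobound_mult x) (α (rng s)) (g s).
Proof.
move=> gx xs; have cs := car_of_mem gx xs; split; first by rewrite Hg // idemM.
move=> b Eb.
have [e [He Ee]] : exists e, idm e /\ α e = supp b by apply: alpha_supp.
have les : e · rng s = e.
  apply: (alpha_inj (L := L)) => //; rewrite alpha_mul // Ee -idem_central //.
  exact: supp_le.
have ex : exists s', x s' /\ α (rng s') = supp b.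
  exists (e · s); split; first exact: class_idem_mul.
  by rewrite rng_idem_mul // les.
have indep s' : x s' -> α (rng s') = supp b -> supp b * g s' = supp b * g s.
  move=> xs' Es'; have cs' := car_of_mem gx xs'.
  have E : e = rng s' by apply: (alpha_inj (L := L)) => //; rewrite Ee Es'.
  rewrite -Ee -!cobound_idem_mul //; congr (g _); apply: sigma_idem_eq => //.
    exact: (class_sigma gx).
  by rewrite E idem_mul.
split.
  set P := fun b' => exists s', x s' /\ α (rng s') = supp b /\ b' = g s' * b.
  have [s' [xs' [Es' H]]] : P (fst (cobound_mult x) b).
    apply: epsilon_spec; have [s' [xs' Es']] := ex.
    by exists (g s' * b), s'.
  rewrite H -{1 2}(suppK b) -!amulA -!(idem_central _ (supp_idem b)).
  by rewrite indep.
set P := fun b' => exists s', x s' /\ α (rng s') = supp b /\ b' = b * g s'.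
have [s' [xs' [Es' H]]] : P (snd (cobound_mult x) b).
  apply: epsilon_spec; have [s' [xs' Es']] := ex.
  by exists (b * g s'), s'.
by rewrite H -(mul_supp b) !amulA indep.
Qed.

Lemma ThetaL_equiv : tpa_equiv G amul Θ Θ'.
Proof.
split.
  move=> x gx a; split=> /(ThetaL_D _ gx) [s [xs E]]; have cs := car_of_mem gx xs;
    apply/(ThetaL_D _ gx); exists s; split=> //; move: E; rewrite Eα //.
have unit x : g_car G x -> is_unit_mult amul (D Θ x) (cobound_mult x).
  move=> gx; apply: is_unit_multP; first exact: ThetaL_ideal.
  move=> b Db Hb; have [s [xs Es]] : exists s, x s /\ α (rng s) = supp b by exact: ThetaL_D_exact.
  exists (g s).
  by rewrite -(supp_of_idem Hb) -Es; apply: cobound_mult_acts.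
exists cobound_mult; split; first exact: unit.
split.
  move=> x a gx /(ThetaL_Dinv _ gx) [s [xs E]]; have cs := car_of_mem gx xs.
  have E' : α' (dom s) * a = a by rewrite Eα.
  rewrite (ThetaL_theta gx xs E) (ThetaL_theta gx xs E') Hλ //.
  have Ha := cobound_mult_acts gx xs; have Hl : α (rng s) * λ s a = λ s a by exact: lam_rng.
  rewrite (actsL Ha Hl).
  have Is : D Θ x (α (rng s)).
    by apply/(ThetaL_D _ gx); exists s; rewrite idemM //; apply: alpha_idem.
  have HI : ideal amul (D Θ x) by exact: ThetaL_ideal.
  pose proof (minv_acts (HI := HI) (unit x gx) Is (alpha_idem (rng_idem cs)) Ha) as Ha'.
  rewrite (actsR Ha') //.
  by rewrite -amulA (idem_central (g s)) // amulA Hl.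
move=> x y a gx gy; pose proof (GS_inv_car gx) as gx'; pose proof (GS_mul_car gx gy) as gxy.
move=> /(ThetaL_setprod _ gx' gy) [Dx Dy].
have [s [xs Es]] : exists s, x s /\ α (dom s) = supp a by exact: ThetaL_Dinv_exact.
have [t [yt Et]] : exists t, y t /\ α (rng t) = supp a by exact: ThetaL_D_exact.
have cs := car_of_mem gx xs; have ct := car_of_mem gy yt.
have Est : rng t = dom s by apply: (alpha_inj (L := L)) => //; rewrite Es Et.
have Rst : rng (s · t) = rng s by rewrite rng_mul_eq.
have Ea : α (dom s) * a = a by rewrite Es suppK.
have Ea' : α' (dom s) * a = a by rewrite Eα.
have Eat : α (rng t) * a = a by rewrite Est.
rewrite (ThetaL_theta gx xs Ea') (ThetaL_wr gx gy xs yt);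
  first by rewrite Rst lam_rng.
rewrite (actsR (cobound_mult_acts gxy (GS_mul_mem gx gy xs yt)));
  first by rewrite Rst -amulA -Eα // lam_rng.
rewrite (actsR (cobound_mult_acts gy yt) Eat).
rewrite (ThetaL_theta gx xs); first by rewrite -amulA Ea.
rewrite (actsL (cobound_mult_acts gx xs)); first exact: lam_rng.
rewrite (ThetaL_wr gx gy xs yt); first by rewrite Rst -amulA (idem_central (g s)) // amulA lam_rng.
(* After the coboundary condition, the g(s)^{-1} closing λ'_s(a) meets the g(s) that opens the next
   factor. *)
rewrite (amulA (λ' s a)) Hf // Hλ // lam_endo // !amulA.
congr (_ * (_ * _)); rewrite -(amulA (g s)^-1) mulVa -(amulA (supp _)).
by rewrite Hg // lam_rng.
Qed.

End ModuleEquivalence.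

(** * From twisted partial actions to Sieben twisted modules *)

Existing Class twisted_partial_action.

(** This is λ_{eδ_x} with θ_{x^-1}(e) in place of the chosen preimage; the two agree because e is
    idempotent. *)
Definition lact {TG A} (G : grp TG) (amul : A -> A -> A) (P : tpa TG A) x e a :=
  theta P x (amul (theta P (g_inv G x) e) a).

Section ActionToModule.

Context {A : Type} {amul : A -> A -> A} {HA : semilattice_of_groups amul}.
Context {TG : Type} {G : grp TG} {HG : group G}.
Context {P : tpa TG A} {HP : twisted_partial_action G amul P}.

Local Notation car := (g_car G).
Local Notation "x ⋆ y" := (g_mul G x y) (at level 40, left associativity).
Local Notation inv := (g_inv G).
Local Notation one := (g_one G).
Local Notation "a * b" := (amul a b).
Local Notation "a ^-1" := (ainv amul a) (at level 3, left associativity, format "a ^-1").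
Local Notation supp := (supp amul).
Local Notation idm := (idemA amul).
Local Notation θ := (theta P).
Local Notation M := (EStar G amul P).
Local Notation lact := (lact G amul P).
Local Notation "s · t" := (s_mul M s t) (at level 40, left associativity).

Implicit Types (a b e f k h : A) (x y z : TG).

Lemma tpa_ideal x : car x -> ideal amul (D P x).
Proof. by case: HP => H _; apply: H. Qed.

Lemma tpa_iso x : car x -> part_iso amul (D P (inv x)) (D P x) (θ x).
Proof. by case: HP => _ [H _]; apply: H. Qed.

Lemma tpa_unit x y : car x -> car y ->
  is_unit_mult amul (setprod amul (D P x) (D P (x ⋆ y))) (w P x y).
Proof. by case: HP => _ [_ [H _]]; apply: H. Qed.

Lemma tpa_D_one a : D P one a.
Proof. by case: HP => _ [_ [_ [_ [_ [H _]]]]]. Qed.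

Lemma tpa_theta_one a : θ one a = a.
Proof. by case: HP => _ [_ [_ [_ [_ [_ [H _]]]]]]. Qed.

Lemma tpa_setprod x y a : car x -> car y ->
  setprod amul (D P x) (D P y) a <-> D P x a /\ D P y a.
Proof. by move=> cx cy; apply: setprodE; apply: tpa_ideal. Qed.

Lemma tpa_image x y a : car x -> car y -> D P (inv x) a -> D P y a ->
  D P (x ⋆ y) (θ x a).
Proof.
case: HP => _ [_ [_ [_ [_ [_ [_ [H _]]]]]]] cx cy Dx Dy.
have [F _] := H x y cx cy (θ x a).
have H1 : setprod amul (D P x) (D P (x ⋆ y)) (θ x a).
  by apply: F; exists a; split=> //; apply/tpa_setprod => //; split.
by move: H1 => /(tpa_setprod _ cx (gmul_car cx cy)) [].
Qed.

Lemma tpa_theta_theta x y a : car x -> car y -> D P (inv y) a -> D P (inv y ⋆ inv x) a ->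
  θ x (θ y a) =
  snd (minv amul (setprod amul (D P x) (D P (x ⋆ y))) (w P x y))
      (fst (w P x y) (θ (x ⋆ y) a)).
Proof.
case: HP => _ [_ [_ [_ [_ [_ [_ [_ [H _]]]]]]]] cx cy Dy Dxy.
by apply: H => //; apply/tpa_setprod => //; split.
Qed.

Lemma tpa_w_one x a : car x -> D P x a -> snd (w P one x) a = a /\ snd (w P x one) a = a.
Proof.
case: HP => _ [_ [_ [_ [_ [_ [_ [_ [_ [H _]]]]]]]]] cx Dx.
by case: (H x cx) => /(_ a Dx) [_ ->] /(_ a Dx) [_ ->].
Qed.

Lemma tpa_cocycle x y z a : car x -> car y -> car z ->
  D P (inv x) a -> D P y a -> D P (y ⋆ z) a ->
  snd (w P x (y ⋆ z)) (θ x (snd (w P y z) a)) =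
  snd (w P (x ⋆ y) z) (snd (w P x y) (θ x a)).
Proof.
case: HP => _ [_ [_ [_ [_ [_ [_ [_ [_ [_ H]]]]]]]]] cx cy cz Dx Dy Dyz.
apply: H => //; apply/setprodE.
- by apply: ideal_setprod; apply: tpa_ideal => //.
- by apply: tpa_ideal => //.
- by split=> //; apply/tpa_setprod => //; split.
Qed.

Lemma theta_D x a : car x -> D P (inv x) a -> D P x (θ x a).
Proof. by move=> cx; case: (tpa_iso cx) => H _; apply: H. Qed.

Lemma theta_inj x a b : car x -> D P (inv x) a -> D P (inv x) b -> θ x a = θ x b -> a = b.
Proof. by move=> cx; case: (tpa_iso cx) => _ [H _]; apply: H. Qed.

Lemma theta_mul x a b : car x -> D P (inv x) a -> D P (inv x) b ->
  θ x (a * b) = θ x a * θ x b.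
Proof. by move=> cx; case: (tpa_iso cx) => _ [_ [_ H]]; apply: H. Qed.

Lemma tpa_D_mulr x a b : car x -> D P x a -> D P x (a * b).
Proof. by move=> cx; apply: ideal_mulr; apply: tpa_ideal. Qed.

Lemma tpa_D_mull x a b : car x -> D P x b -> D P x (a * b).
Proof. by move=> cx; apply: ideal_mull; apply: tpa_ideal. Qed.

Lemma tpa_D_inv_inv x a : car x -> D P x a -> D P (inv (inv x)) a.
Proof. by move=> cx; rewrite ginv_inv. Qed.

Hint Resolve theta_D tpa_D_mulr tpa_D_mull tpa_D_one tpa_D_inv_inv : car.

Lemma theta_idem x e : car x -> D P (inv x) e -> idm e -> idm (θ x e).
Proof. by move=> cx De He; apply: idemA_intro; rewrite -theta_mul // idemM. Qed.

Hint Resolve theta_idem : car.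

(** The composition axiom with the multiplier replaced by its translating element at any idempotent
    [k] above the value. *)
Lemma theta_theta_conj x y k a : car x -> car y ->
  D P (inv y) a -> D P (inv y ⋆ inv x) a ->
  idm k -> D P x k -> D P (x ⋆ y) k -> k * θ (x ⋆ y) a = θ (x ⋆ y) a ->
  θ x (θ y a) = snd (w P x y) k * θ (x ⋆ y) a * (snd (w P x y) k)^-1.
Proof.
move=> cx cy Dy Dxy Hk kx kxy E; rewrite tpa_theta_theta //.
set I := setprod amul _ _.
have HI : ideal amul I by apply: ideal_setprod; apply: tpa_ideal => //.
have Ik : I k by apply/tpa_setprod => //; split.
have Hu : is_unit_mult amul I (w P x y) by apply: tpa_unit.
have [_ Ha] := unit_mult_acts (HI := HI) Hu Ik Hk.
pose proof (minv_acts (HI := HI) Hu Ik Hk Ha) as Ha'.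
rewrite (actsL Ha E) (actsR Ha') //.
by rewrite -amulA (idem_central (snd _ _)) // amulA E.
Qed.

Lemma tpa_w_supp x y k : car x -> car y -> idm k -> D P x k -> D P (x ⋆ y) k ->
  supp (snd (w P x y) k) = k /\ acts amul (w P x y) k (snd (w P x y) k).
Proof.
move=> cx cy Hk kx kxy; apply: (@unit_mult_acts _ _ _ (setprod amul (D P x) (D P (x ⋆ y)))) => //.
- by apply: ideal_setprod; apply: tpa_ideal => //.
- exact: tpa_unit.
- by apply/tpa_setprod => //; split.
Qed.

Lemma theta_theta_idem x y e : car x -> car y -> idm e ->
  D P (inv y) e -> D P (inv y ⋆ inv x) e -> θ x (θ y e) = θ (x ⋆ y) e.
Proof.
move=> cx cy He Dy Dxy.
have Dxy' : D P (inv (x ⋆ y)) e by rewrite ginv_mul.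
have k1 : D P (x ⋆ y) (θ (x ⋆ y) e) by apply: theta_D => //.
have k2 : D P x (θ (x ⋆ y) e).
  by rewrite -{1}(gmulKV cx cy); apply: tpa_image => //.
have k3 : idm (θ (x ⋆ y) e) by apply: theta_idem => //.
rewrite (@theta_theta_conj x y (θ (x ⋆ y) e)) // ?idemM //.
have [sc _] := tpa_w_supp cx cy k3 k2 k1.
by rewrite conj_idem // sc idemM.
Qed.

Lemma theta_invK x e : car x -> idm e -> D P (inv x) e -> θ (inv x) (θ x e) = e.
Proof.
move=> cx He De.
have D1 : D P (inv x ⋆ inv (inv x)) e by rewrite gmulV //; apply: tpa_D_one.
by rewrite theta_theta_idem // gVmul // tpa_theta_one.
Qed.

Lemma thetaK_inv x e : car x -> idm e -> D P x e -> θ x (θ (inv x) e) = e.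
Proof.
by move=> cx He De; rewrite -{1}(ginv_inv cx); apply: theta_invK => //; auto with car.
Qed.

Lemma theta_inv_idem x e : car x -> idm e -> D P x e -> theta_inv G P x e = θ (inv x) e.
Proof.
move=> cx He De; rewrite -{1}(thetaK_inv cx He De).
by apply: (pinv_left (tpa_iso cx)); apply: theta_D => //; auto with car.
Qed.

Lemma pull_D x e : car x -> D P x e -> D P (inv x) (θ (inv x) e).
Proof. by move=> cx De; apply: theta_D => //; auto with car. Qed.

Lemma pull_idem x e : car x -> idm e -> D P x e -> idm (θ (inv x) e).
Proof. by move=> cx He De; apply: theta_idem => //; auto with car. Qed.

Hint Resolve pull_D pull_idem : car.

Lemma lact_D x e a : car x -> D P x e -> D P x (lact x e a).
Proof. by move=> cx De; apply: theta_D => //; apply: tpa_D_mulr => //. Qed.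

Lemma lact_idem x e a : car x -> D P x e -> idm e -> idm a -> idm (lact x e a).
Proof.
by move=> cx De He Ha; apply: theta_idem => //; apply: tpa_D_mulr => //.
Qed.

Lemma lact_image x y e a : car x -> car y -> D P x e -> D P y a ->
  D P (x ⋆ y) (lact x e a).
Proof.
by move=> cx cy De Da; apply: tpa_image.
Qed.

Hint Resolve lact_D lact_idem lact_image : car.

Lemma lact_mul x e a b : car x -> idm e -> D P x e ->
  lact x e (a * b) = lact x e a * lact x e b.
Proof.
move=> cx He De; have He' : idm (θ (inv x) e) by apply: pull_idem.
rewrite /lact -theta_mul //; try by apply: tpa_D_mulr => //.
by rewrite amulA -(amulA a) -(idem_central a He') amulA idemK.
Qed.

Lemma mul_lact x e a : car x -> idm e -> D P x e -> e * lact x e a = lact x e a.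
Proof.
move=> cx He De; rewrite -{1}(thetaK_inv cx He De) /lact -theta_mul //.
by rewrite idemK //; apply: pull_idem.
Qed.

Lemma lact_one e a : idm e -> lact one e a = e * a.
Proof. by move=> He; rewrite /lact ginv_one !tpa_theta_one. Qed.

Lemma lact_pull x e : car x -> idm e -> D P x e -> lact x e (θ (inv x) e) = e.
Proof.
by move=> cx He De; rewrite /lact idemM ?thetaK_inv //; apply: pull_idem.
Qed.

(** Both sides reduce to values of θ at h a, where h = θ_{y^-1}(θ_{x^-1}(e) f) is the domain
    idempotent of the product: θ_xθ_y on the left, θ_{xy} on the right. *)
Lemma lact_lact x y e f a : car x -> car y -> idm e -> D P x e -> idm f -> D P y f ->
  lact x e (lact y f a) =
  snd (w P x y) (lact x e f) * lact (x ⋆ y) (lact x e f) a *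
    (snd (w P x y) (lact x e f))^-1.
Proof.
move=> cx cy He De Hf Df.
have ixe := pull_idem cx He De; have Dxe := pull_D cx De.
have iyf := pull_idem cy Hf Df; have Dyf := pull_D cy Df.
set e' := θ (inv x) e in ixe Dxe *; set f' := θ (inv y) f in iyf Dyf *.
have ief : idm (e' * f) by apply: idemA_mul.
have Dx : D P (inv x) (e' * f) by apply: tpa_D_mulr => //.
have Dy : D P y (e' * f) by apply: tpa_D_mull.
set h := θ (inv y) (e' * f).
have ih : idm h by apply: pull_idem.
have Dh : D P (inv y) h by apply: pull_D.
have Dh' : D P (inv y ⋆ inv x) h by apply: tpa_image => //; auto with car.
have Eh : θ y h = e' * f by apply: thetaK_inv.
have hf : h * f' = h.
  rewrite /h /f' -theta_mul; auto with car.
  by rewrite amulA idemM.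
have E1 : e' * lact y f a = θ y (h * a).
  rewrite -hf amulA theta_mul //.
  by rewrite Eh amulA mul_lact.
have Ek : lact x e f = θ (x ⋆ y) h by rewrite -theta_theta_idem // Eh.
have Dxy : D P (inv (x ⋆ y)) h by rewrite ginv_mul.
have E2 : θ (inv (x ⋆ y)) (lact x e f) = h by rewrite Ek theta_invK.
have F1 : idm (lact x e f) by apply: lact_idem.
have F2 : D P x (lact x e f) by apply: lact_D.
have F3 : D P (x ⋆ y) (lact x e f) by apply: lact_image.
have F4 : D P (inv y) (h * a) by apply: tpa_D_mulr => //.
have F5 : D P (inv y ⋆ inv x) (h * a) by apply: tpa_D_mulr => //.
have F6 : lact x e f * θ (x ⋆ y) (h * a) = θ (x ⋆ y) (h * a).
  by rewrite Ek -theta_mul ?idemK //; apply: tpa_D_mulr => //.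
by rewrite {1}/lact -/e' E1 (theta_theta_conj cx cy F4 F5 F1 F2 F3 F6) /(lact (x ⋆ y)) E2.
Qed.

Lemma lact_lact_idem x y e f k : car x -> car y ->
  idm e -> D P x e -> idm f -> D P y f -> idm k ->
  lact x e (lact y f k) = lact (x ⋆ y) (lact x e f) k.
Proof.
move=> cx cy He De Hf Df Hk.
have F1 : idm (lact x e f) by apply: lact_idem.
have F2 : D P x (lact x e f) by apply: lact_D.
have F3 : D P (x ⋆ y) (lact x e f) by apply: lact_image.
have F4 : idm (lact (x ⋆ y) (lact x e f) k) by apply: lact_idem => //.
rewrite lact_lact // conj_idem //.
have [-> _] := tpa_w_supp cx cy F1 F2 F3.
by rewrite mul_lact.
Qed.

(** * The semigroup of pairs as an E-unitary inverse semigroup *)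

Lemma EStar_car x e : car x -> idm e -> D P x e -> s_car M (e, x).
Proof. by move=> cx He De; split. Qed.

Lemma EStar_carE x e : s_car M (e, x) -> car x /\ idm e /\ D P x e.
Proof. by []. Qed.

Lemma EStar_mul x y e f : car x -> idm e -> D P x e ->
  s_mul M (e, x) (f, y) = (lact x e f, x ⋆ y).
Proof. by move=> cx He De; rewrite /= theta_inv_idem. Qed.

Hint Resolve EStar_car : car.

Lemma EStar_closed_assoc : closed_assoc M.
Proof.
split.
  by move=> [e x] [f y] /EStar_carE [cx [He De]] /EStar_carE [cy [Hf Df]]; rewrite EStar_mul.
move=> [e x] [f y] [k z] /EStar_carE [cx [He De]] /EStar_carE [cy [Hf Df]] /EStar_carE [cz [Hk Dk]].
have F1 : idm (lact x e f) by apply: lact_idem.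
have F3 : D P (x ⋆ y) (lact x e f) by apply: lact_image.
rewrite !EStar_mul // ?gmulA // lact_lact_idem //.
Qed.

Lemma EStar_is_inverse x e : car x -> idm e -> D P x e ->
  is_inverse_of M (e, x) (θ (inv x) e, inv x).
Proof.
move=> cx He De; have He' := pull_idem cx He De; have De' := pull_D cx De.
split; first by apply: EStar_car => //.
have D1 := tpa_D_one; split.
  rewrite !EStar_mul ?lact_pull // gmulV // lact_one // idemM // g1mul //.
rewrite !EStar_mul // gVmul //.
have -> : lact (inv x) (θ (inv x) e) e = θ (inv x) e.
  by rewrite /lact ginv_inv // thetaK_inv // idemM.
by rewrite lact_one // idemM // g1mul.
Qed.

Lemma EStar_idem_one x e : idem M (e, x) -> x = one.
Proof. by case=> /EStar_carE [cx _] [_ E]; apply: gmul_idem. Qed.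

Lemma EStar_idem e : idm e -> idem M (e, one).
Proof.
move=> He; have D1 := tpa_D_one; split; first by apply: EStar_car => //.
by rewrite EStar_mul // lact_one // idemM // g1mul.
Qed.

Hint Resolve EStar_idem : car.

#[export] Instance EStar_inverse_semigroup : inverse_semigroup M.
Proof.
apply: inverse_semigroup_of_comm_idem.
- exact: EStar_closed_assoc.
- case: HA => -[_ [[a _] _]] _; exists (supp a, one).
  by apply: EStar_car => //; apply: tpa_D_one.
- move=> [e x] /EStar_carE [cx [He De]]; exists (θ (inv x) e, inv x).
  exact: EStar_is_inverse.
- move=> [e x] [f y] Ie If.
  have Ex := EStar_idem_one Ie; have Ey := EStar_idem_one If; subst x y.
  case: (Ie) => /EStar_carE [_ [He De]] _; case: (If) => /EStar_carE [_ [Hf Df]] _.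
  by rewrite !EStar_mul // !lact_one // idem_central.
Qed.

Lemma EStar_inv x e : car x -> idm e -> D P x e ->
  sinv M (e, x) = (θ (inv x) e, inv x).
Proof.
by move=> cx He De; apply: inv_uniq; [apply: EStar_car | apply: EStar_is_inverse].
Qed.

Lemma EStar_rng x e : car x -> idm e -> D P x e -> rng M (e, x) = (e, one).
Proof.
move=> cx He De; rewrite rngE EStar_inv // EStar_mul // lact_pull // gmulV //.
Qed.

Lemma EStar_dom x e : car x -> idm e -> D P x e -> dom M (e, x) = (θ (inv x) e, one).
Proof.
move=> cx He De; have He' := pull_idem cx He De; have De' := pull_D cx De.
rewrite domE EStar_inv // EStar_mul // gVmul //.
by rewrite /lact ginv_inv // thetaK_inv // idemM.
Qed.

(** The idempotents are exactly the elements of degree one, and multiplying by one of them preserves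
    the degree. *)
Lemma EStar_E_unitary : E_unitary M.
Proof.
move=> [e x] [f y] Ie /EStar_carE [cy [Hf Df]] [[k z] [Ik E]].
have Ex := EStar_idem_one Ie; have Ez := EStar_idem_one Ik; subst x z.
case: (Ik) => /EStar_carE [_ [Hk Dk]] _.
move: E; rewrite EStar_mul // => -[_]; rewrite g1mul // => <-.
exact: EStar_idem.
Qed.

(** * The module axioms for Λ^Θ *)

Local Notation L := (LambdaT G amul P).

Lemma LambdaT_lam x e a : car x -> idm e -> D P x e -> lam L (e, x) a = lact x e a.
Proof. by move=> cx He De; rewrite /= theta_inv_idem. Qed.

Lemma LambdaT_fco x y e f : car x -> idm e -> D P x e ->
  fco L (e, x) (f, y) = snd (w P x y) (lact x e f).
Proof. by move=> cx He De; rewrite /= theta_inv_idem. Qed.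

Lemma LambdaT_fco_supp x y e f : car x -> idm e -> D P x e -> car y -> idm f -> D P y f ->
  supp (fco L (e, x) (f, y)) = lact x e f.
Proof.
move=> cx He De cy Hf Df; rewrite LambdaT_fco //.
by have [] := tpa_w_supp cx cy (lact_idem cx De He Hf) (lact_D f cx De) (lact_image cx cy De Df).
Qed.

Lemma LambdaT_idem_iso : idem_iso M amul (alpha L).
Proof.
split; [|split; [|split]].
- by move=> [e x] [[_ []]].
- move=> [e x] [f y] /EStar_idem_one -> /EStar_idem_one -> /= -> //.
- by move=> e He; exists (e, one); split=> //; apply: EStar_idem.
- move=> [e x] [f y] Ie If.
  have Ex := EStar_idem_one Ie; have Ey := EStar_idem_one If; subst x y.
  case: (Ie) => /EStar_carE [_ [He De]] _; rewrite -[LHS]/(fst (s_mul M (e, one) (f, one))).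
  by rewrite EStar_mul // lact_one.
Qed.

Lemma lact_rel_invertible x e : car x -> idm e -> D P x e ->
  rel_invertible amul (lact x e).
Proof.
move=> cx He De; have He' := pull_idem cx He De; have De' := pull_D cx De.
have Ee' := thetaK_inv cx He De; set e' := θ (inv x) e in He' De' Ee' *.
(* The relative inverse must cancel without any conjugation, which rules out θ_{x^-1} on
   non-idempotent arguments. *)
pose psi b := theta_inv G P x (e * b).
have Dp b : D P (inv x) (psi b).
  by apply: (proj1 (pinv_spec (tpa_iso cx) _)); apply: tpa_D_mulr.
have Tp b : θ x (psi b) = e * b.
  by apply: (proj2 (pinv_spec (tpa_iso cx) _)); apply: tpa_D_mulr.
have pE b a : D P (inv x) a -> θ x a = e * b -> psi b = a.
  by move=> Da E; apply: (theta_inj cx) => //; rewrite Tp.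
have ep b : e' * psi b = psi b.
  by apply: (theta_inj cx) => //; rewrite theta_mul // Ee' Tp idemK.
split; first by move=> a b; apply: lact_mul.
exists psi, e'; split.
  move=> a b; apply: pE; first by apply: tpa_D_mulr.
  by rewrite theta_mul // !Tp amulA -(amulA a) -(idem_central a He) amulA idemK.
split=> //; split.
  by move=> a; apply: pE; [apply: tpa_D_mulr | rewrite mul_lact].
split; first by move=> a; rewrite /lact -/e' ep Tp (idemM He') Ee'.
split.
  split; first by exists e; apply: pE => //; rewrite idemM.
  by move=> a; rewrite ep -idem_central.
split; first by exists e'.
have Le : lact x e e' = e by exact: lact_pull.
by move=> a; rewrite Le; split; last rewrite -idem_central //; apply: mul_lact.
Qed.

Lemma LambdaT_twisted_identity s t a : s_car M s -> s_car M t ->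
  lam L s (lam L t a) =
  fco L s t * lam L (s · t) a * (fco L s t)^-1.
Proof.
case: s t => e x [f y] /EStar_carE [cx [He De]] /EStar_carE [cy [Hf Df]].
rewrite EStar_mul // LambdaT_fco // !LambdaT_lam //; auto with car.
exact: lact_lact.
Qed.

Lemma LambdaT_cocycle s t u : s_car M s -> s_car M t -> s_car M u ->
  lam L s (fco L t u) * fco L s (t · u) = fco L s t * fco L (s · t) u.
Proof.
case: s t u => e x [f y] [k z] /EStar_carE [cx [He De]] /EStar_carE [cy [Hf Df]].
move=> /EStar_carE [cz [Hk Dk]].
have F1 : idm (lact x e f) by apply: lact_idem.
have F2 : D P (x ⋆ y) (lact x e f) by apply: lact_image.
have F0 : D P x (lact x e f) by apply: lact_D.
have F3 : idm (lact y f k) by apply: lact_idem.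
have F4 : D P (y ⋆ z) (lact y f k) by apply: lact_image.
have F5 : D P y (lact y f k) by apply: lact_D.
have He' := pull_idem cx He De; have De' := pull_D cx De.
rewrite !EStar_mul // !LambdaT_fco // LambdaT_lam // -lact_lact_idem //.
set q := lact y f k in F3 F4 F5 *.
have [sc Hc] := tpa_w_supp cy cz F3 F5 F4.
have [sd Hd] := tpa_w_supp cx cy F1 F0 F2.
set c := snd (w P y z) q in sc Hc *.
set d := snd (w P x y) (lact x e f) in sd Hd *.
(* The cocycle identity of the action is evaluated at the idempotent that θ_x sends to the range of
   the triple product. There each multiplier is translation by a value of f. *)
pose m := θ (inv x) e * q.
have Dm : D P (inv x) m by apply: tpa_D_mulr => //.
have im : idm m by apply: idemA_mul.
have Em : θ x m = lact x e q by [].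
have qm : q * m = m by rewrite /m -(idem_central q) // amulA idemM.
have Ew : snd (w P y z) m = m * c by rewrite (actsR Hc).
have Er : lact x e f * θ x m = θ x m.
  have fq : f * q = q by exact: mul_lact.
  by rewrite Em -lact_mul // fq.
have := tpa_cocycle cx cy cz Dm (tpa_D_mull (θ (inv x) e) cy F5)
  (tpa_D_mull (θ (inv x) e) (gmul_car cy cz) F4).
rewrite Ew (actsR Hd Er).
have R0 : idm (lact x e q) by apply: lact_idem.
have R1 : D P x (lact x e q) by apply: lact_D.
have R2 : D P (x ⋆ (y ⋆ z)) (lact x e q) by apply: lact_image => //; auto with car.
have R3 : D P (x ⋆ y) (lact x e q) by apply: lact_image.
have R4 : D P (x ⋆ y ⋆ z) (lact x e q) by rewrite gmulA.
have [s1 H1] := tpa_w_supp cx (gmul_car cy cz) R0 R1 R2.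
have [s2 H2] := tpa_w_supp (gmul_car cx cy) cz R0 R3 R4.
rewrite (actsR H1); first by rewrite -Em -theta_mul // ?idemK //; apply: tpa_D_mulr.
rewrite -Em in s1 s2 R0 *; rewrite (actsR H2); first by rewrite -Em idemK.
have -> : lact x e c = θ x (m * c).
  by rewrite /lact /m amulA -{1}sc suppK.
have rc : θ x m * snd (w P (x ⋆ y) z) (θ x m) = snd (w P (x ⋆ y) z) (θ x m).
  by rewrite -{1}s2 suppK.
by move=> ->; rewrite (idem_central d) // amulA rc.
Qed.

Lemma LambdaT_fco_idem s t : s_car M s -> idem M t ->
  fco L s t = alpha L (rng M (s · t)) /\ fco L t s = alpha L (rng M (t · s)).
Proof.
case: s t => e x [f y] /EStar_carE [cx [He De]] Hf.
have Ey := EStar_idem_one Hf; subst y; case: Hf => /EStar_carE [c1 [Hf Df]] _.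
have F1 : idm (lact x e f) by apply: lact_idem.
have F2 : D P x (lact x e f) by apply: lact_D.
split.
  by rewrite LambdaT_fco // EStar_mul // gmul1 // EStar_rng //; case: (tpa_w_one cx F2).
have F3 : D P x (f * e) by apply: tpa_D_mull.
rewrite LambdaT_fco // EStar_mul // lact_one // g1mul // EStar_rng //.
by case: (tpa_w_one cx F3).
Qed.

#[export] Instance LambdaT_sieben_module : sieben_module M amul L.
Proof.
split; last first.
  move=> s t cs He; have [-> ->] := LambdaT_fco_idem cs He.
  by rewrite rng_mul_idem // rng_idem_mulE.
split; first exact: LambdaT_idem_iso.
split.
  move=> [e x] /EStar_carE [cx [He De]] /=; rewrite theta_inv_idem //.
  exact: lact_rel_invertible.
split.
  move=> s t cs ct; rewrite -rng_mulE //; apply/HgrpE.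
  case: s t cs ct => e x [f y] /EStar_carE [cx [He De]] /EStar_carE [cy [Hf Df]].
  rewrite LambdaT_fco_supp // EStar_mul // EStar_rng //; auto with car.
split.
  move=> [e x] a Ie; have Ex := EStar_idem_one Ie; subst x.
  case: Ie => /EStar_carE [c1 [He De]] _.
  by rewrite LambdaT_lam // lact_one.
split.
  move=> s t cs He; rewrite -rng_mul_idem //.
  have ct := idem_car He.
  case: s t cs ct He => e x [f y] /EStar_carE [cx [He De]] /EStar_carE [cy [Hf Df]] _.
  by rewrite LambdaT_lam // EStar_mul // EStar_rng //; auto with car.
split; first exact: LambdaT_twisted_identity.
split; last exact: LambdaT_cocycle.
move=> s t cs He.
have [-> _] := LambdaT_fco_idem (mul_car cs (idem_car He)) He.
have [_ ->] := LambdaT_fco_idem (mul_car (idem_car He) cs) He.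
split; first by rewrite mulA // idem_mul // rng_mul_idem.
by rewrite idem_mulK // rng_idem_mulE.
Qed.

(** * Recovering the group and the action from Λ^Θ *)

Lemma EStar_sigma x y e f : s_car M (e, x) -> s_car M (f, y) ->
  sigma M (e, x) (f, y) <-> x = y.
Proof.
move=> ce cf; have /EStar_carE [cx [He De]] := ce; have /EStar_carE [cy [Hf Df]] := cf.
split.
  case=> _ [_ [[k z] [Ik]]]; have Ez := EStar_idem_one Ik; subst z.
  case: Ik => /EStar_carE [c1 [Hk Dk]] _.
  by rewrite !EStar_mul // !g1mul // => -[].
move=> E; subst y; split=> //; split=> //; exists (e * f, one); split.
  by apply: EStar_idem; apply: idemA_mul.
have Hef : idm (e * f) by apply: idemA_mul.
have D1 := tpa_D_one.
have E1 : e * f * e = e * f by rewrite amulA -(idem_central f He) idemK.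
have E2 : e * f * f = e * f by rewrite amulA idemM.
by rewrite !EStar_mul // !lact_one // E1 E2.
Qed.

(** Written by degree, not as the σ-class of a pair, so that no idempotent of D_x has to be
    selected. *)
Definition degree_class x : A * TG -> Prop := fun p => s_car M p /\ snd p = x.

Lemma degree_classE x e : s_car M (e, x) -> degree_class x = sigma M (e, x).
Proof.
move=> ce; apply: functional_extensionality => -[f y].
apply: propositional_extensionality; split.
  by case=> cf /= E; apply/EStar_sigma.
by move=> H; case: (H) => _ [cf _]; split=> //=; move/EStar_sigma: H => ->.
Qed.

(** Since the ideals are nonempty every degree occurs, and so each [degree_class x] is a genuine
    σ-class. *)
Lemma D_idem_inhabited x : car x -> exists e, s_car M (e, x).
Proof.
move=> cx; pose proof (tpa_ideal cx) as HI; have [[a Da] _] := HI.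
by exists (supp a); apply: EStar_car => //; apply: ideal_supp.
Qed.

Lemma degree_class_car x : car x -> g_car (GS M) (degree_class x).
Proof.
move=> cx; have [e ce] := D_idem_inhabited cx.
by rewrite (degree_classE ce); apply: GS_car_class.
Qed.

Lemma degree_class_mem x e : car x -> idm e -> D P x e -> degree_class x (e, x).
Proof. by move=> cx He De; split=> //; apply: EStar_car. Qed.

Lemma degree_class_iso : grp_iso G (GS M) degree_class.
Proof.
split; first exact: degree_class_car.
split.
  move=> x y cx cy E; have [e ce] := D_idem_inhabited cx.
  have : degree_class x (e, x) by split.
  by rewrite E => -[].
split.
  move=> _ [[e x] [cp ->]]; have /EStar_carE [cx _] := cp.
  by exists x; split=> //; apply: degree_classE.
move=> x y cx cy; have [e ce] := D_idem_inhabited cx; have [f cf] := D_idem_inhabited cy.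
rewrite (degree_classE ce) (degree_classE cf) GS_mulE //.
have /EStar_carE [_ [He De]] := ce; pose proof (mul_car ce cf) as cef.
by move: cef; rewrite EStar_mul //; apply: degree_classE.
Qed.

Local Notation Θ := (ThetaL M amul L).

Lemma degree_class_tpa_eq : tpa_eq G amul P (tpa_comp Θ degree_class).
Proof.
have HU : E_unitary M := EStar_E_unitary.
move=> x cx; pose proof (degree_class_car cx) as gx.
pose proof (tpa_ideal cx) as HI.
split.
  move=> a; split.
    move=> Da; have Ds : D P x (supp a) by apply: ideal_supp.
    apply/(ThetaL_D _ gx); exists (supp a, x); split; first exact: degree_class_mem.
    by rewrite EStar_rng //= suppK.
  move=> /(ThetaL_D _ gx) [[e y] [[/EStar_carE [cy [He De]] /= E]]]; subst y.
  by rewrite EStar_rng //= => <-; apply: tpa_D_mulr.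
split.
  move=> a Da.
  have Ds : D P (inv x) (supp a).
    by apply: ideal_supp => //; apply: tpa_ideal => //.
  (* The pair with first entry θ_x([supp a]) is the element of degree x whose domain is the support
     of [a]. *)
  have Dt : D P x (θ x (supp a)) by apply: theta_D.
  have it : idm (θ x (supp a)) by apply: theta_idem => //.
  have mt := degree_class_mem cx it Dt.
  have E : alpha L (dom M (θ x (supp a), x)) * a = a.
    by rewrite EStar_dom //= theta_invK // suppK.
  rewrite [RHS](ThetaL_theta gx mt E) LambdaT_lam // /lact theta_invK // suppK.
  by [].
move=> y cy a /(tpa_setprod _ cx (gmul_car cx cy)) [Dx Dxy].
pose proof (degree_class_car cy) as gy.
have Ds : D P x (supp a) by apply: ideal_supp.
have Ds' : D P (x ⋆ y) (supp a) by apply: ideal_supp => //; apply: tpa_ideal => //.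
have ms : degree_class x (supp a, x) by exact: degree_class_mem.
(* This idempotent is the domain of ([supp a], x). Taking it as the range of the second element
   makes the product have range [supp a]. *)
have iu : idm (θ (inv x) (supp a)) by apply: pull_idem.
have Du : D P y (θ (inv x) (supp a)).
  by rewrite -(gVmulK cx cy); apply: tpa_image => //; auto with car.
have mu := degree_class_mem cy iu Du.
have E : alpha L (rng M ((supp a, x) · (θ (inv x) (supp a), y))) * a = a.
  by rewrite EStar_mul // lact_pull // EStar_rng //= suppK.
rewrite [fst (w (tpa_comp _ _) _ _) a](ThetaL_wl gx gy ms mu E).
rewrite [snd (w (tpa_comp _ _) _ _) a](ThetaL_wr gx gy ms mu E).
rewrite LambdaT_fco // lact_pull //.
have [_ Ha] := tpa_w_supp cx cy (supp_idem a) Ds Ds'.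
by rewrite (actsL Ha (suppK a)) (actsR Ha (suppK a)).
Qed.

End ActionToModule.

#[export] Hint Extern 1 (D _ _ (theta _ _ _)) => apply: theta_D : car.

(** * From equivalent actions to equivalent modules *)

Section ActionEquivalence.

Context {A : Type} {amul : A -> A -> A} {HA : semilattice_of_groups amul}.
Context {TG : Type} {G : grp TG} {HG : group G}.
Context {P P' : tpa TG A} {HP : twisted_partial_action G amul P}.
Context {HP' : twisted_partial_action G amul P'}.

Local Notation car := (g_car G).
Local Notation "x ⋆ y" := (g_mul G x y) (at level 40, left associativity).
Local Notation inv := (g_inv G).
Local Notation "a * b" := (amul a b).
Local Notation "a ^-1" := (ainv amul a) (at level 3, left associativity, format "a ^-1").
Local Notation supp := (supp amul).
Local Notation idm := (idemA amul).
Local Notation θ := (theta P).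
Local Notation θ' := (theta P').
Local Notation M := (EStar G amul P).

Hypothesis HD : forall x, car x -> seteq (D P' x) (D P x).
Context (eps : TG -> mult A).
Hypothesis Hunit : forall x, car x -> is_unit_mult amul (D P x) (eps x).
Hypothesis Hconj : forall x a, car x -> D P (inv x) a ->
  θ' x a = snd (minv amul (D P x) (eps x)) (fst (eps x) (θ x a)).
Hypothesis Hcob : forall x y a, car x -> car y ->
  setprod amul (D P (inv x)) (D P y) a ->
  snd (eps (x ⋆ y)) (snd (w P' x y) (θ' x a)) =
  snd (w P x y) (fst (eps x) (θ x (snd (eps y) a))).

Lemma eps_acts x e : car x -> idm e -> D P x e ->
  supp (snd (eps x) e) = e /\ acts amul (eps x) e (snd (eps x) e).
Proof.
move=> cx He De; pose proof (tpa_ideal (P := P) cx) as HI.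
exact: (unit_mult_acts (HI := HI) (Hunit cx)).
Qed.

Lemma equiv_theta x k a : car x -> idm k -> D P x k -> D P (inv x) a ->
  k * θ x a = θ x a ->
  θ' x a = snd (eps x) k * θ x a * (snd (eps x) k)^-1.
Proof.
move=> cx Hk Dk Da E; rewrite Hconj //.
pose proof (tpa_ideal (P := P) cx) as HI.
have [_ Ha] := eps_acts cx Hk Dk.
pose proof (minv_acts (HI := HI) (Hunit cx) Dk Hk Ha) as Ha'.
rewrite (actsL Ha E) (actsR Ha') //.
by rewrite -amulA (idem_central (snd _ _)) // amulA E.
Qed.

(** Conjugation fixes idempotents below its support. Equivalent actions thus multiply pairs in the
    same way, so both modules live over the semigroup built from [P]. *)
Lemma equiv_theta_idem x e : car x -> idm e -> D P (inv x) e -> θ' x e = θ x e.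
Proof.
move=> cx He De; have Ht : idm (θ x e) by exact: theta_idem.
have Dt : D P x (θ x e) by exact: theta_D.
rewrite (equiv_theta cx Ht Dt De) ?idemM //.
have [sc _] := eps_acts cx Ht Dt.
by rewrite conj_idem // sc idemM.
Qed.

Lemma equiv_lact x e a : car x -> idm e -> D P x e ->
  lact G amul P' x e a = θ' x (θ (inv x) e * a).
Proof.
by move=> cx He De; rewrite /lact (@equiv_theta_idem (inv x) e) //; apply: tpa_D_inv_inv.
Qed.

Lemma equiv_lact_conj x e a : car x -> idm e -> D P x e ->
  lact G amul P' x e a =
  snd (eps x) e * lact G amul P x e a * (snd (eps x) e)^-1.
Proof.
move=> cx He De; rewrite equiv_lact // (equiv_theta cx He De) //.
  by apply: tpa_D_mulr => //; apply: pull_D.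
exact: mul_lact.
Qed.

Lemma equiv_lact_idem x e f : car x -> idm e -> D P x e -> idm f ->
  lact G amul P' x e f = lact G amul P x e f.
Proof.
move=> cx He De Hf; have He' : idm (θ (inv x) e) by exact: pull_idem.
rewrite equiv_lact // equiv_theta_idem //.
by apply: tpa_D_mulr => //; apply: pull_D.
Qed.

Lemma LambdaT_equiv : tms_equiv M amul (LambdaT G amul P) (LambdaT G amul P').
Proof.
(* The coboundary is g(eδ_x) = e ε_x, the element by which ε_x translates below e. *)
split=> //; exists (fun s => snd (eps (snd s)) (fst s)); split.
  move=> [e x] [cx [He De]]; rewrite /= in cx He De.
  apply/HgrpE; rewrite -rngE EStar_rng //=.
  by case: (eps_acts cx He De).
split.
  move=> [e x] a [cx [He De]]; rewrite /= in cx He De.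
  have De1 : D P' x e by apply/HD.
  by rewrite !LambdaT_lam //; apply: equiv_lact_conj.
move=> [e x] [f y] [cx [He De]] [cy [Hf Df]]; rewrite /= in cx He De cy Hf Df.
have De1 : D P' x e by apply/HD.
rewrite EStar_mul // !LambdaT_fco // LambdaT_lam // equiv_lact_idem //=.
set k := lact G amul P x e f.
have ik : idm k by exact: lact_idem.
have Dk : D P x k by exact: lact_D.
have Dk' : D P (x ⋆ y) k by exact: lact_image.
have cxy : car (x ⋆ y) by [].
have [sx Hx] := eps_acts cx He De; have [sy Hy] := eps_acts cy Hf Df.
have [sxy Hxy] := eps_acts cxy ik Dk'.
have [_ Hw] : supp (snd (w P x y) k) = k /\ acts amul (w P x y) k (snd (w P x y) k).
  exact: tpa_w_supp.
have [sw' _] : supp (snd (w P' x y) k) = k /\ acts amul (w P' x y) k (snd (w P' x y) k).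
  by apply: tpa_w_supp => //; apply/HD.
have He' : idm (θ (inv x) e) by exact: pull_idem.
have De' : D P (inv x) (θ (inv x) e) by exact: pull_D.
(* The equivalence condition is used at this idempotent, since θ_x sends it to [k], the range of the
   product. *)
pose m := θ (inv x) e * f.
have Dm : D P (inv x) m by apply: tpa_D_mulr.
have im : idm m by exact: idemA_mul.
have fm : f * m = m by rewrite /m -(idem_central f) // amulA idemM.
have fy : f * snd (eps y) f = snd (eps y) f by rewrite -{1}sy suppK.
have Dym : setprod amul (D P (inv x)) (D P y) m.
  by apply/tpa_setprod => //; split=> //; apply: tpa_D_mull.
have := Hcob cx cy Dym; rewrite equiv_theta_idem // -[θ x m]/k.
rewrite (actsR Hxy); first by rewrite -{1}sw' suppK.
rewrite (actsR Hy fm) /m amulA fy -/(lact G amul P x e (snd (eps y) f)).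
rewrite (actsL Hx); first exact: mul_lact.
rewrite (actsR Hw) // -amulA (idem_central (snd (eps x) e)) // amulA /k -lact_mul //.
by rewrite fy.
Qed.

End ActionEquivalence.

Theorem theorem9p3 :
  forall (A : Type) (amul : A -> A -> A),
  semilattice_of_groups amul ->
  (* Lambda |-> Theta^Lambda, and back *)
  (forall (T : Type) (S : sgrp T) (L : tms T A),
     inverse_semigroup S -> E_unitary S -> sieben_module S amul L ->
     group (GS S) /\ twisted_partial_action (GS S) amul (ThetaL S amul L) /\
     exists nu : T -> A * (T -> Prop),
       sgrp_iso S (EStar (GS S) amul (ThetaL S amul L)) nu /\
       tms_eq S L (tms_comp (LambdaT (GS S) amul (ThetaL S amul L)) nu)) /\
  (* Theta |-> Lambda^Theta, and back *)
  (forall (TG : Type) (G : grp TG) (P : tpa TG A),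
     group G -> twisted_partial_action G amul P ->
     inverse_semigroup (EStar G amul P) /\ E_unitary (EStar G amul P) /\
     sieben_module (EStar G amul P) amul (LambdaT G amul P) /\
     exists nu : TG -> (A * TG -> Prop),
       grp_iso G (GS (EStar G amul P)) nu /\
       tpa_eq G amul P
         (tpa_comp (ThetaL (EStar G amul P) amul (LambdaT G amul P)) nu)) /\
  (* equivalent Sieben module structures give equivalent twisted partial actions *)
  (forall (T : Type) (S : sgrp T) (L L' : tms T A),
     inverse_semigroup S -> E_unitary S ->
     sieben_module S amul L -> sieben_module S amul L' ->
     tms_equiv S amul L L' ->
     tpa_equiv (GS S) amul (ThetaL S amul L) (ThetaL S amul L')) /\
  (* equivalent twisted partial actions give equivalent Sieben module structures *)
  (forall (TG : Type) (G : grp TG) (P P' : tpa TG A),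
     group G -> twisted_partial_action G amul P -> twisted_partial_action G amul P' ->
     tpa_equiv G amul P P' ->
     tms_equiv (EStar G amul P) amul (LambdaT G amul P) (LambdaT G amul P')).
Proof.
move=> A amul HA; split; [|split; [|split]].
- move=> T S L HS HU HL; split; first exact: GS_group.
  split; first exact: ThetaL_twisted_partial_action.
  exists (module_iso (S := S) (L := L)).
  by split; [apply: module_iso_sgrp_iso | apply: module_iso_tms_eq].
- move=> TG G P HG HP; split; first exact: EStar_inverse_semigroup.
  split; first exact: EStar_E_unitary.
  split; first exact: LambdaT_sieben_module.
  exists (degree_class (G := G) (amul := amul) (P := P)).
  by split; [apply: degree_class_iso | apply: degree_class_tpa_eq].
- move=> T S L L' HS HU HL HL' [Ha [g [Hg [Hlam Hf]]]].
  apply: (ThetaL_equiv Ha (g := g)) => // s cs.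
  by rewrite rngE; apply/HgrpE/Hg.
- move=> TG G P P' HG HP HP' [HD [eps [H1 [H2 H3]]]].
  exact: (LambdaT_equiv HD H1 H2 H3).
Qed.
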